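(* Let $k$ be an algebraically closed field and $n\ge 3$. Let $(x,y)\in\mathbf{F}$, where $\mathbf{F}=\{(x,y)\mid \frac{2}{n}x\le y\le x\}$ (pairs of positive integers), with $n<x<2n$, and let $M$ be a finite-dimensional $\mathcal{K}_n$-module with dimension vector $(x,y)$. Suppose that $M$ is elementary. Then there exist two elements $m',m''\in M_1$ such that $\underline{\dim}\,\Lambda_n.m'=(1,y-1)$ and $\underline{\dim}\,\Lambda_n.m''=(1,y)$.
   Context: The $n$-Kronecker quiver $K(n)$ has two vertices $1,2$ and $n$ arrows $\gamma_1,\dots,\gamma_n:1\to 2$; $\mathcal{K}_n=kK(n)$ is its path algebra. Finite-dimensional $\mathcal{K}_n$-modules are identified with finite-dimensional representations $M=(M_1,M_2,(M(\gamma_i))_{1\le i\le n})$, where $M(\gamma_i):M_1\to M_2$ are $k$-linear maps between finite-dimensional $k$-vector spaces. The dimension vector is $\underline{\dim}\,M=(\dim_k M_1,\dim_k M_2)$. For $m\in M_1$ write $\gamma_i.m:=M(\gamma_i)(m)$, and let $\Lambda_n.m$ denote the submodule of $M$ generated by $m$; for $m\ne 0$ it has first component $km$ and second component $\operatorname{span}_k(\gamma_1.m,\dots,\gamma_n.m)$. An indecomposable module $M$ is regular if $\tau^t M\neq 0$ for all $t\in\mathbb{Z}$, where $\tau$ is the Auslander--Reiten translation (equivalently, $M$ is neither preprojective nor preinjective); a module is called regular if all its indecomposable direct summands are regular. A nonzero regular module $M$ is elementary if there is no short exact sequence $0\to L\to M\to N\to 0$ with $L,N$ nonzero regular modules. 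*)

(* Defs.v *)
From HB Require Import structures.
From mathcomp Require Import all_boot all_order all_algebra.

Set Implicit Arguments.
Unset Strict Implicit.
Unset Printing Implicit Defensive.

Import Order.TTheory GRing.Theory Num.Theory.
Local Open Scope ring_scope.

Section KroneckerRepresentations.
Variables (k : fieldType) (n : nat).

Record krep := KRep {
  krep1 : vectType k;
  krep2 : vectType k;
  karr : 'I_n -> 'Hom(krep1, krep2) }.

Definition dimvec (M : krep) : nat * nat :=
  (\dim {:krep1 M}, \dim {:krep2 M}).

Definition is_zero (M : krep) : Prop := dimvec M = (0%N, 0%N).

Record khom (M N : krep) := KHom {
  khom1 : 'Hom(krep1 M, krep1 N);
  khom2 : 'Hom(krep2 M, krep2 N);
  khomP : forall i, (khom2 \o karr M i = karr N i \o khom1)%VF }.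

Definition kmono M N (f : khom M N) : Prop :=
  injective (khom1 f) /\ injective (khom2 f).

Definition kepi M N (f : khom M N) : Prop :=
  limg (khom1 f) = fullv /\ limg (khom2 f) = fullv.

Definition kiso M N : Prop := exists f : khom M N, kmono f /\ kepi f.

Definition kexact L M N (f : khom L M) (g : khom M N) : Prop :=
  limg (khom1 f) = lker (khom1 g) /\ limg (khom2 f) = lker (khom2 g).

Definition short_exact L M N (f : khom L M) (g : khom M N) : Prop :=
  [/\ kmono f, kexact f g & kepi g].

Record ksub (M : krep) := KSub {
  ksub1 : {vspace krep1 M};
  ksub2 : {vspace krep2 M};
  ksubP : forall i, (karr M i @: ksub1 <= ksub2)%VS }.

Definition krep_of_sub M (U : ksub M) : krep :=
  KRep (fun i => linfun (vsproj (ksub2 U) \o karr M i \o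
                         (vsval : subvs_of (ksub1 U) -> krep1 M))).

Fact gen_ksubP M (m : krep1 M) i :
  (karr M i @: <[m]> <= <<[seq karr M j m | j <- enum 'I_n]>>)%VS.
Proof.
rewrite limg_line -memvE; apply: memv_span.
by apply: (map_f (fun j => karr M j m)); rewrite mem_enum.
Qed.

Definition gen_ksub M (m : krep1 M) : ksub M := KSub (gen_ksubP m).

Lemma gen_ksub_min M (m : krep1 M) (U : ksub M) : m \in ksub1 U ->
  (ksub1 (gen_ksub m) <= ksub1 U)%VS /\ (ksub2 (gen_ksub m) <= ksub2 U)%VS.
Proof.
move=> mU; split; first by rewrite -memvE.
apply/span_subvP => _ /mapP[j _ ->].
exact: subvP (ksubP U j) _ (memv_img _ mU).
Qed.

Fact kkerP M N (f : khom M N) i :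
  (karr M i @: lker (khom1 f) <= lker (khom2 f))%VS.
Proof.
apply/subvP => v /memv_imgP[u]; rewrite !memv_ker => /eqP fu0 ->.
by rewrite -comp_lfunE khomP comp_lfunE fu0 linear0.
Qed.

Definition kker M N (f : khom M N) : ksub M := KSub (kkerP f).

Definition ksum (M N : krep) : krep :=
  @KRep (krep1 M * krep1 N)%type (krep2 M * krep2 N)%type
    (fun i => linfun (fun u : krep1 M * krep1 N =>
                        (karr M i u.1, karr N i u.2))).

Definition indecomposable (M : krep) : Prop :=
  ~ is_zero M /\ forall A B, kiso M (ksum A B) -> is_zero A \/ is_zero B.

Definition direct_summand (N M : krep) : Prop :=
  exists N', kiso M (ksum N N').

(* I(1) (x) V and I(2) (x) V, where I(j) is the indecomposable injective whose
   value at the vertex i is the dual of the span of the paths from i to j. *)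
Definition inj1 (V : vectType k) : krep :=
  @KRep V 'rV[k]_0 (fun=> 0).

Definition inj2 (V : vectType k) : krep :=
  @KRep {ffun 'I_n -> V} V (fun j => linfun (fun w : {ffun 'I_n -> V} => w j)).

(* M has the projective resolution
     0 -> P(2) (x) M_1^n -> (P(1) (x) M_1) + (P(2) (x) M_2) -> M -> 0,
   whose first map sends (m_i)_i in the vertex-2 component to
   (sum_i gamma_i (x) m_i, sum_i gamma_i.m_i)  (and the second one sends
   (p (x) m, m') to p.m - m').  nu_res M is the image of the first map under
   the Nakayama functor nu, which replaces P(i) by I(i) and right
   multiplication by gamma_i, P(2) -> P(1), by evaluation at gamma_i,
   I(2) -> I(1). *)
Section NakayamaResolution.
Variable M : krep.

Definition nu_src : krep := inj2 {ffun 'I_n -> krep1 M}.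
Definition nu_tgt : krep := ksum (inj1 (krep1 M)) (inj2 (krep2 M)).

Definition nu_res1_fun (w : {ffun 'I_n -> {ffun 'I_n -> krep1 M}}) :
    krep1 M * {ffun 'I_n -> krep2 M} :=
  (\sum_i w i i, [ffun j => \sum_i karr M i (w j i)]).

Definition nu_res2_fun (v : {ffun 'I_n -> krep1 M}) :
    'rV[k]_0 * krep2 M :=
  (0, \sum_i karr M i (v i)).

Fact nu_res1_linear : linear nu_res1_fun.
Proof.
move=> a u v; congr pair => /=.
  by rewrite scaler_sumr -big_split; apply: eq_bigr => i _; rewrite !ffunE.
apply/ffunP => j; rewrite !ffunE scaler_sumr -big_split.
by apply: eq_bigr => i _; rewrite !ffunE linearP.
Qed.
HB.instance Definition _ :=
  GRing.isLinear.Build _ _ _ _ nu_res1_fun nu_res1_linear.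

Fact nu_res2_linear : linear nu_res2_fun.
Proof.
move=> a u v; congr pair => /=; first by rewrite scaler0 addr0.
rewrite scaler_sumr -big_split.
by apply: eq_bigr => i _; rewrite !ffunE linearP.
Qed.
HB.instance Definition _ :=
  GRing.isLinear.Build _ _ _ _ nu_res2_fun nu_res2_linear.

Fact inj2_arrE V j w : karr (inj2 V) j w = w j.
Proof.
have lin : linear (fun w : {ffun 'I_n -> V} => w j).
  by move=> a u v; rewrite !ffunE.
pose ev := HB.pack_for {linear {ffun 'I_n -> V} -> V}
  (fun w : {ffun 'I_n -> V} => w j) (GRing.isLinear.Build _ _ _ _ _ lin).
exact: (lfunE ev).
Qed.

Fact ksum_arrE A B j u : karr (ksum A B) j u = (karr A j u.1, karr B j u.2).
Proof.
pose h (u : krep1 A * krep1 B) := (karr A j u.1, karr B j u.2).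
have lin : linear h by move=> a v w; congr pair; exact: linearP.
pose hl := HB.pack_for
  {linear (krep1 A * krep1 B)%type -> (krep2 A * krep2 B)%type}
  h (GRing.isLinear.Build _ _ _ _ _ lin).
exact: (lfunE hl).
Qed.

Definition nu_res1 : 'Hom(krep1 nu_src, krep1 nu_tgt) := linfun nu_res1_fun.
Definition nu_res2 : 'Hom(krep2 nu_src, krep2 nu_tgt) := linfun nu_res2_fun.

Fact nu_res1E w : nu_res1 w = nu_res1_fun w.
Proof. exact: lfunE. Qed.

Fact nu_res2E v : nu_res2 v = nu_res2_fun v.
Proof. exact: lfunE. Qed.

Fact nu_resP j : (nu_res2 \o karr nu_src j = karr nu_tgt j \o nu_res1)%VF.
Proof.
apply/lfunP => w; rewrite !comp_lfunE nu_res1E nu_res2E ksum_arrE.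
rewrite !inj2_arrE; congr pair; first by rewrite lfunE.
by rewrite ffunE; apply: eq_bigr => i _.
Qed.

Definition nu_res : khom nu_src nu_tgt := KHom nu_resP.

End NakayamaResolution.

(* Auslander-Reiten translation: tau M = Ker(nu P_1 -> nu P_0); the algebra
   being hereditary, the resolution 0 -> P_1 -> P_0 -> M -> 0 need not be
   minimal. *)
Definition tau (M : krep) : krep := krep_of_sub (kker (nu_res M)).

(* The k-duality, composed with the identification of the opposite of K(n)
   with K(n). *)
Definition kdual (M : krep) : krep :=
  @KRep 'Hom(krep2 M, k^o) 'Hom(krep1 M, k^o)
    (fun i => linfun (fun f : 'Hom(krep2 M, k^o) => (f \o karr M i)%VF)).

(* tau^{-1} = Tr D = D (D Tr) D. *)
Definition tau_inv (M : krep) : krep := kdual (tau (kdual M)).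

Definition tau_pow (t : int) (M : krep) : krep :=
  match t with
  | Posz s => iter s tau M
  | Negz s => iter s.+1 tau_inv M
  end.

Definition regular_indec (M : krep) : Prop :=
  indecomposable M /\ forall t : int, ~ is_zero (tau_pow t M).

Definition regular (M : krep) : Prop :=
  forall N, indecomposable N -> direct_summand N M -> regular_indec N.

Definition elementary (M : krep) : Prop :=
  [/\ ~ is_zero M, regular M &
    ~ exists (L N : krep) (f : khom L M) (g : khom M N),
        [/\ short_exact f g, ~ is_zero L, ~ is_zero N, regular L & regular N]].

End KroneckerRepresentations.

Definition regionF (n x y : nat) : Prop :=
  [/\ (0 < x)%N, (0 < y)%N, 2 / n%:R * x%:R <= y%:R :> rat & (y <= x)%N].

(* Main.v *)
From HB Require Import structures.
Require Import Defs.
From mathcomp Require Import all_boot all_order all_algebra.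
From mathcomp Require Import realalg ring lra zify.
From Stdlib Require Import Classical.

(* For subrepresentations U of M put degP U = lam u1 - u2 and
   degI U = lam u2 - u1, where (u1, u2) is the dimension vector of U and lam is
   the larger root of t^2 - n t + 1.  A representation is regular iff degP is
   strictly smaller on its proper subrepresentations and degI is positive on its
   nonzero ones: tau is the square of a shift functor sigma, which acts on
   dimension vectors by (a, b) |-> (n a - b, a) and preserves this condition,
   whereas an indecomposable representation that violates it has a quotient (or,
   dually, a subrepresentation) whose dimension vectors shrink along the tau-orbit
   until the orbit dies.  A Harder-Narasimhan argument then shows that an
   elementary M has no subrepresentation U with degP U > 0 and degI U < degI M.

   Let n < x < 2n and y <= x.  Applied to U = Lambda.m this gives
   dim (Lambda.m)_2 >= y - 1 as soon as this dimension is < n; applied to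
   U = ({v | l (gamma_i.v) = 0 for all i}, Ker l) it shows that the forms
   l o gamma_i are linearly independent for every l <> 0.  An eigenvector of the
   pencil spanned by two arrows gives y <= n, and any m' <> 0 killed by all
   l o gamma_i spans a module of dimension vector (1, y - 1).  If c is a relation
   between the gamma_i.m' and l a form vanishing on Lambda.m', some v has
   l (sum_i c_i gamma_i.v) <> 0, so m' + t v generates (1, y) for suitable t. *)

Set Implicit Arguments.
Unset Strict Implicit.
Unset Printing Implicit Defensive.

Import Order.TTheory GRing.Theory Num.Theory.
Local Open Scope ring_scope.

(** * Subrepresentations and slopes *)

Section Sublattice.
Variables (k : fieldType) (n : nat).
Implicit Types X Y : krep k n.

Definition kdim1 X (U : ksub X) := \dim (ksub1 U).
Definition kdim2 X (U : ksub X) := \dim (ksub2 U).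
Definition ksize X (U : ksub X) := (kdim1 U + kdim2 U)%N.

Definition kle X (U V : ksub X) :=
  (ksub1 U <= ksub1 V)%VS && (ksub2 U <= ksub2 V)%VS.

Fact kbotP X i : (karr X i @: 0 <= 0)%VS.
Proof. by rewrite limg0. Qed.
Definition kbot X : ksub X := KSub (@kbotP X).

Fact ktopP X i : (karr X i @: fullv <= fullv)%VS.
Proof. exact: subvf. Qed.
Definition ktop X : ksub X := KSub (@ktopP X).

Fact kcapP X (U V : ksub X) i :
  (karr X i @: (ksub1 U :&: ksub1 V) <= ksub2 U :&: ksub2 V)%VS.
Proof.
rewrite subv_cap (subv_trans (limgS _ (capvSl _ _)) (ksubP U i)).
exact: subv_trans (limgS _ (capvSr _ _)) (ksubP V i).
Qed.
Definition kcap X (U V : ksub X) : ksub X := KSub (kcapP U V).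

Fact kaddP X (U V : ksub X) i :
  (karr X i @: (ksub1 U + ksub1 V) <= ksub2 U + ksub2 V)%VS.
Proof. by rewrite limgD; apply: addvS; apply: ksubP. Qed.
Definition kadd X (U V : ksub X) : ksub X := KSub (kaddP U V).

Lemma kle_refl X (U : ksub X) : kle U U.
Proof. by rewrite /kle !subvv. Qed.

Lemma kle_trans X (U V W : ksub X) : kle U V -> kle V W -> kle U W.
Proof.
by move=> /andP[a b] /andP[c d]; rewrite /kle (subv_trans a c) (subv_trans b d).
Qed.

Lemma kle_top X (U : ksub X) : kle U (ktop X).
Proof. by rewrite /kle !subvf. Qed.

Lemma kle_bot X (U : ksub X) : kle (kbot X) U.
Proof. by rewrite /kle !sub0v. Qed.

Lemma kle_capl X (U V : ksub X) : kle (kcap U V) U.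
Proof. by rewrite /kle !capvSl. Qed.

Lemma kle_capr X (U V : ksub X) : kle (kcap U V) V.
Proof. by rewrite /kle !capvSr. Qed.

Lemma kle_addl X (U V : ksub X) : kle U (kadd U V).
Proof. by rewrite /kle !addvSl. Qed.

Lemma kle_addr X (U V : ksub X) : kle V (kadd U V).
Proof. by rewrite /kle !addvSr. Qed.

Lemma kle_cap X (U V W : ksub X) : kle W (kcap U V) = kle W U && kle W V.
Proof. by rewrite /kle !subv_cap -!andbA; do !bool_congr. Qed.

Lemma kle_add X (U V W : ksub X) : kle (kadd U V) W = kle U W && kle V W.
Proof. by rewrite /kle !subv_add -!andbA; do !bool_congr. Qed.

Lemma kle_dim X (U V : ksub X) :
  kle U V -> (kdim1 U <= kdim1 V)%N /\ (kdim2 U <= kdim2 V)%N.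
Proof. by case/andP => a b; split; apply: dimvS. Qed.

Lemma kle_size X (U V : ksub X) : kle U V -> (ksize U <= ksize V)%N.
Proof. by case/kle_dim; rewrite /ksize; lia. Qed.

Lemma kle_eq X (U V : ksub X) :
  kle U V -> (ksize V <= ksize U)%N -> ksub1 U = ksub1 V /\ ksub2 U = ksub2 V.
Proof.
move=> leUV; have [d1 d2] := kle_dim leUV; case/andP: leUV => s1 s2 sz.
split; apply/eqP; rewrite eqEdim ?s1 ?s2 /=;
  by move: sz d1 d2; rewrite /ksize /kdim1 /kdim2; lia.
Qed.

Lemma kdim_cap X (U V : ksub X) :
  (kdim1 (kadd U V) + kdim1 (kcap U V) = kdim1 U + kdim1 V)%N /\
  (kdim2 (kadd U V) + kdim2 (kcap U V) = kdim2 U + kdim2 V)%N.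
Proof. by split; apply: dimv_sum_cap. Qed.

Lemma kdim_bot X : kdim1 (kbot X) = 0%N /\ kdim2 (kbot X) = 0%N.
Proof. by rewrite /kdim1 /kdim2 /= !dimv0. Qed.

End Sublattice.

Section Slopes.
Variables (k : fieldType) (n : nat) (R : realFieldType) (lam : R).
Implicit Types X Y : krep k n.

Definition degP X (U : ksub X) : R := lam * (kdim1 U)%:R - (kdim2 U)%:R.
Definition degI X (U : ksub X) : R := lam * (kdim2 U)%:R - (kdim1 U)%:R.

(* [noP A U] and [noI A U] say that the subquotient U/A has no preprojective
   quotient and no preinjective submodule, respectively. *)
Definition noP X (A U : ksub X) := forall W : ksub X,
  kle A W -> kle W U -> (ksize W < ksize U)%N -> degP W < degP U.
Definition noI X (A U : ksub X) := forall W : ksub X,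
  kle A W -> kle W U -> (ksize A < ksize W)%N -> degI A < degI W.
(** Numerical regularity of the subquotient [U/A]. Keeping both ends inside one [X] covers
    submodules ([A = kbot X]) and quotients ([U = ktop X]) without constructing either
    representation. *)
Definition nreg X (A U : ksub X) := noP A U /\ noI A U.

Lemma degP_cap X (U V : ksub X) :
  degP (kadd U V) + degP (kcap U V) = degP U + degP V.
Proof.
have [d1 d2] := kdim_cap U V; rewrite /degP.
move/(congr1 (fun m : nat => m%:R : R)): d1.
move/(congr1 (fun m : nat => m%:R : R)): d2.
by rewrite !natrD => d2 d1; rewrite addrACA -mulrDr d1 -opprD d2; ring.
Qed.

Lemma deg_dim X (U V : ksub X) : kdim1 U = kdim1 V -> kdim2 U = kdim2 V ->
  degP U = degP V /\ degI U = degI V.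
Proof. by rewrite /degP /degI => -> ->. Qed.

Lemma deg_eq X (U V : ksub X) : kle U V -> (ksize V <= ksize U)%N ->
  degP U = degP V /\ degI U = degI V.
Proof.
move=> le sz; have [e1 e2] := kle_eq le sz.
by apply: deg_dim; rewrite /kdim1 /kdim2 ?e1 ?e2.
Qed.

Lemma deg_bot X : degP (kbot X) = 0 /\ degI (kbot X) = 0.
Proof.
by rewrite /degP /degI; have [-> ->] := kdim_bot X; rewrite mulr0 subr0.
Qed.

Lemma noP_le X (A U W : ksub X) :
  noP A U -> kle A W -> kle W U -> degP W <= degP U.
Proof.
move=> h aw wu; have := kle_size wu; rewrite leq_eqVlt => /orP[/eqP e|lt].
  by rewrite (deg_eq wu _).1 // e.
exact/ltW/h.
Qed.

Lemma noI_le X (A U W : ksub X) :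
  noI A U -> kle A W -> kle W U -> degI A <= degI W.
Proof.
move=> h aw wu; have := kle_size aw; rewrite leq_eqVlt => /orP[/eqP e|lt].
  by rewrite (deg_eq aw _).2 // e.
exact/ltW/h.
Qed.

(** Only dimension vectors enter the slopes, so no isomorphism between [U/A] and [V/B] has to be
    built: once the total dimension vectors agree, it suffices that each submodule of [V/B] has a
    counterpart in [U/A] of the same dimension vector. *)
Lemma noP_transfer X (A U : ksub X) Y (B V : ksub Y) :
  (kdim1 U + kdim1 B = kdim1 V + kdim1 A)%N ->
  (kdim2 U + kdim2 B = kdim2 V + kdim2 A)%N ->
  (forall W, kle B W -> kle W V -> exists W', [/\ kle A W', kle W' U,
     (kdim1 W' + kdim1 B = kdim1 W + kdim1 A)%N &
     (kdim2 W' + kdim2 B = kdim2 W + kdim2 A)%N]) ->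
  noP A U -> noP B V.
Proof.
move=> t1 t2 h hP W bw wv sz; have [W' [aw wu d1 d2]] := h W bw wv.
have /(hP W' aw wu) : (ksize W' < ksize U)%N by move: sz; rewrite /ksize; lia.
rewrite /degP.
move/(congr1 (fun m : nat => m%:R : R)): d1.
move/(congr1 (fun m : nat => m%:R : R)): d2.
move/(congr1 (fun m : nat => m%:R : R)): t1.
move/(congr1 (fun m : nat => m%:R : R)): t2.
rewrite !natrD => t2 t1 d2 d1.
by nra.
Qed.

Lemma noI_transfer X (A U : ksub X) Y (B V : ksub Y) :
  (forall W, kle B W -> kle W V -> exists W', [/\ kle A W', kle W' U,
     (kdim1 W' + kdim1 B = kdim1 W + kdim1 A)%N &
     (kdim2 W' + kdim2 B = kdim2 W + kdim2 A)%N]) ->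
  noI A U -> noI B V.
Proof.
move=> h hI W bw wv sz; have [W' [aw wu d1 d2]] := h W bw wv.
have /(hI W' aw wu) : (ksize A < ksize W')%N by move: sz; rewrite /ksize; lia.
rewrite /degI.
move/(congr1 (fun m : nat => m%:R : R)): d1.
move/(congr1 (fun m : nat => m%:R : R)): d2.
rewrite !natrD => d2 d1.
by nra.
Qed.

Lemma nreg_transfer X (A U : ksub X) Y (B V : ksub Y) :
  (kdim1 U + kdim1 B = kdim1 V + kdim1 A)%N ->
  (kdim2 U + kdim2 B = kdim2 V + kdim2 A)%N ->
  (forall W, kle B W -> kle W V -> exists W', [/\ kle A W', kle W' U,
     (kdim1 W' + kdim1 B = kdim1 W + kdim1 A)%N &
     (kdim2 W' + kdim2 B = kdim2 W + kdim2 A)%N]) ->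
  nreg A U -> nreg B V.
Proof.
move=> t1 t2 h [hP hI].
by split; [apply: noP_transfer hP | apply: noI_transfer hI].
Qed.

(** Duality swaps the two vertices and turns submodules into quotients, so it exchanges [degP] with
    [degI] and hence the two halves of [nreg]. *)
Lemma nreg_dual X (A U : ksub X) Y (B V : ksub Y) :
  (kdim1 U + kdim2 B = kdim2 V + kdim1 A)%N ->
  (kdim2 U + kdim1 B = kdim1 V + kdim2 A)%N ->
  (forall W, kle B W -> kle W V -> exists W', [/\ kle A W', kle W' U,
     (kdim1 W' + kdim2 W = kdim2 V + kdim1 A)%N &
     (kdim2 W' + kdim1 W = kdim1 V + kdim2 A)%N]) ->
  nreg A U -> nreg B V.
Proof.
move=> t1 t2 h [hP hI]; split=> W bw wv sz;
  have [W' [aw wu d1 d2]] := h W bw wv.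
- have /(hI W' aw wu) : (ksize A < ksize W')%N by move: sz; rewrite /ksize; lia.
  rewrite /degI /degP.
  move/(congr1 (fun m : nat => m%:R : R)): d1.
  move/(congr1 (fun m : nat => m%:R : R)): d2.
  rewrite !natrD => d2 d1.
  by nra.
- have /(hP W' aw wu) : (ksize W' < ksize U)%N by move: sz; rewrite /ksize; lia.
  rewrite /degI /degP.
  move/(congr1 (fun m : nat => m%:R : R)): d1.
  move/(congr1 (fun m : nat => m%:R : R)): d2.
  move/(congr1 (fun m : nat => m%:R : R)): t1.
  move/(congr1 (fun m : nat => m%:R : R)): t2.
  rewrite !natrD => t2 t1 d2 d1.
  by nra.
Qed.

End Slopes.

(** * Direct sums, extremal submodules and the Harder-Narasimhan argument *)

Section Splitting.
Variables (k : fieldType) (n : nat) (R : realFieldType) (lam : R).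
Implicit Types X Y : krep k n.

(** [W] itself need not split along [A] and [B], but its dimension vector does: [W1] is the kernel
    and [W2] the image of the projection of [W] to [B] along [A]. The count rests on the modular
    law. *)
Lemma sum_dim_split X (A B W : ksub X) :
  ksize (kcap A B) = 0%N -> kle W (kadd A B) -> exists W1 W2,
  [/\ kle W1 A, kle W2 B, kdim1 W = (kdim1 W1 + kdim1 W2)%N &
      kdim2 W = (kdim2 W1 + kdim2 W2)%N].
Proof.
move=> AB0 leW.
exists (kcap W A), (kcap (kadd W A) B); split; rewrite ?kle_capr //.
- have modW : ksub1 (kadd A (kcap B (kadd W A))) = ksub1 (kadd W A).
    rewrite /= vspace_modl ?addvSr //; apply/capv_idPr.
    by case/andP: leW => h _; rewrite subv_add h addvSl.
  have [h1 _] := kdim_cap W A.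
  have [h2 _] := kdim_cap A (kcap B (kadd W A)).
  have : (kdim1 (kcap A (kcap B (kadd W A))) <= kdim1 (kcap A B))%N.
    by apply: dimvS; rewrite capvS // capvSl.
  move: h1 h2 AB0; rewrite /ksize /kdim1 modW /= [(ksub1 B :&: _)%VS]capvC.
  lia.
- have modW : ksub2 (kadd A (kcap B (kadd W A))) = ksub2 (kadd W A).
    rewrite /= vspace_modl ?addvSr //; apply/capv_idPr.
    by case/andP: leW => _ h; rewrite subv_add h addvSl.
  have [_ h1] := kdim_cap W A.
  have [_ h2] := kdim_cap A (kcap B (kadd W A)).
  have : (kdim2 (kcap A (kcap B (kadd W A))) <= kdim2 (kcap A B))%N.
    by apply: dimvS; rewrite capvS // capvSl.
  move: h1 h2 AB0; rewrite /ksize /kdim2 modW /= [(ksub2 B :&: _)%VS]capvC.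
  lia.
Qed.

Lemma deg_split X (U V W : ksub X) : kdim1 W = (kdim1 U + kdim1 V)%N ->
  kdim2 W = (kdim2 U + kdim2 V)%N ->
  degP lam W = degP lam U + degP lam V /\ degI lam W = degI lam U + degI lam V.
Proof. by rewrite /degP /degI => -> ->; rewrite !natrD; split; ring. Qed.

Lemma nreg_sum X (A B : ksub X) : ksize (kcap A B) = 0%N ->
  nreg lam (kbot X) A -> nreg lam (kbot X) B -> nreg lam (kbot X) (kadd A B).
Proof.
move=> AB0 [PA IA] [PB IB].
have [eP eI] : degP lam (kadd A B) = degP lam A + degP lam B /\
               degI lam (kadd A B) = degI lam A + degI lam B.
  apply: deg_split; have [h1 h2] := kdim_cap A B;
    move: AB0 h1 h2; rewrite /ksize; lia.
have [d1 d2] := kdim_cap A B.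
split=> W _ leW sz; have [W1 [W2 [l1 l2 e1 e2]]] := sum_dim_split AB0 leW;
  have [fP fI] := deg_split e1 e2.
- rewrite fP eP.
  have := noP_le PA (kle_bot W1) l1; have := noP_le PB (kle_bot W2) l2.
  have : (ksize W1 < ksize A)%N \/ (ksize W2 < ksize B)%N.
    by move: sz AB0 d1 d2 e1 e2; rewrite /ksize; lia.
  case=> [/(PA _ (kle_bot _) l1)|/(PB _ (kle_bot _) l2)]; lra.
- have [_ z] := deg_bot lam X; rewrite fI z.
  have := noI_le IA (kle_bot W1) l1; have := noI_le IB (kle_bot W2) l2.
  have [b1 b2] := kdim_bot X.
  have : (ksize (kbot X) < ksize W1)%N \/ (ksize (kbot X) < ksize W2)%N.
    by move: sz e1 e2; rewrite /ksize b1 b2; lia.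
  case=> [/(IA _ (kle_bot _) l1)|/(IB _ (kle_bot _) l2)]; rewrite z; lra.
Qed.

(** There may be infinitely many submodules, but [phi] sees only their dimension vectors, of which
    there are finitely many. Maxima are obtained by negating [phi]. *)
Lemma ksub_ex_min X (P : ksub X -> Prop) (phi : nat -> nat -> R) U0 : P U0 ->
  exists2 U, P U & forall W, P W ->
    phi (kdim1 U) (kdim2 U) <= phi (kdim1 W) (kdim2 W).
Proof.
move=> PU0.
pose dims (W : ksub X) := (kdim1 W, kdim2 W).
suff H : forall s : seq (nat * nat), (exists2 U, P U & dims U \in s) ->
    exists2 U, P U & forall W, P W -> dims W \in s ->
      phi (kdim1 U) (kdim2 U) <= phi (kdim1 W) (kdim2 W).
  pose s := [seq (a, b) | a <- iota 0 (ksize (ktop X)).+1,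
                          b <- iota 0 (ksize (ktop X)).+1].
  have ins W : dims W \in s.
    have [h1 h2] := kle_dim (kle_top W).
    by apply/allpairs_f; rewrite mem_iota; move: h1 h2; rewrite /ksize; lia.
  have [|U PU minU] := H s; first by exists U0.
  by exists U => // W PW; apply: minU.
elim=> [[U _]//|[a b] s IH [U PU Us]].
have [[V PV Vs]|none] := classic (exists2 V, P V & dims V \in s); last first.
  exists U => // W PW; rewrite inE => /orP[/eqP Wab|Ws]; last first.
    by case: none; exists W.
  move: Us; rewrite inE => /orP[/eqP|Us]; last by case: none; exists U.
  by move: Wab => [-> ->] [-> ->].
have [V' PV' minV'] := IH (ex_intro2 _ _ V PV Vs).
have [[V2 [PV2 dV2 lt2]]|no] := classic (exists V2, [/\ P V2,
  dims V2 = (a, b) & phi a b < phi (kdim1 V') (kdim2 V')]).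
  exists V2 => // W PW; case: dV2 => -> ->.
  rewrite inE => /orP[/eqP[-> ->]//|/(minV' _ PW)].
  exact: le_trans (ltW lt2).
exists V' => // W PW; rewrite inE => /orP[/eqP Wab|]; last exact: minV'.
rewrite leNgt; apply/negP => lt; apply: no; exists W.
by move: (Wab) lt => [-> ->] lt; split.
Qed.

Hypothesis lam_gt1 : 1 < lam.

(** The hypothesis says that [degI] does not increase from [A] to [U]. With C and D the growth at
    the two vertices, C >= lam D and lam > 1 give lam C - D >= (lam - 1) C, which is positive unless
    C = D = 0. *)
Lemma degP_mono X (A U : ksub X) : kle A U ->
  (kdim1 U)%:R - (kdim1 A)%:R >= lam * ((kdim2 U)%:R - (kdim2 A)%:R) ->
  degP lam A <= degP lam U /\ ((ksize A < ksize U)%N -> degP lam A < degP lam U).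
Proof.
move=> /kle_dim[]; rewrite /degP /ksize.
move: (kdim1 A) (kdim2 A) (kdim1 U) (kdim2 U) => a b c d ac bd.
rewrite -!natrB // => h; have := ler0n R (d - b); have := ler0n R (c - a).
have -> : c%:R = a%:R + (c - a)%:R :> R by rewrite -natrD subnKC.
have -> : d%:R = b%:R + (d - b)%:R :> R by rewrite -natrD subnKC.
move=> C0 D0; have l0 : 0 <= lam - 1 by rewrite subr_ge0 ltW.
have lC := mulr_ge0 l0 C0; have lD := mulr_ge0 l0 D0.
have pC : (0 < c - a)%N -> 0 < (c - a)%:R :> R by rewrite ltr0n.
have pD : (0 < d - b)%N -> 0 < (d - b)%:R :> R by rewrite ltr0n.
have zC : (c - a = 0)%N -> (c - a)%:R = 0 :> R by move=> ->.
have cases : (a + b < c + d)%N -> (0 < c - a)%N \/ (c - a = 0 /\ 0 < d - b)%N.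
  by clear -ac bd; lia.
move: (c - a)%:R (d - b)%:R h C0 D0 lC lD pC pD zC.
move=> C D h C0 D0 lC lD pC pD zC; split=> [|/cases]; first by lra.
case=> [/pC p|[/zC z /pD p]]; last by rewrite z in h lC *; lra.
by have := mulr_gt0 (_ : 0 < lam - 1) p; rewrite subr_gt0 => /(_ lam_gt1); lra.
Qed.

(* First shrink [U] to its largest submodule [L0] without preprojective
   quotient, then enlarge [L0] until the quotient has no preinjective
   submodule left. *)
Lemma nreg_split X (U : ksub X) : nreg lam (kbot X) (ktop X) ->
  0 < degP lam U -> degI lam U < degI lam (ktop X) ->
  exists L : ksub X, [/\ (0 < ksize L)%N, (ksize L < ksize (ktop X))%N,
     nreg lam (kbot X) L & nreg lam L (ktop X)].
Proof.
move=> [PX IX] PU IU.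
(* [L1] has maximal [degP] inside [U]; [L0] is a smallest submodule of [U] reaching that value, so
   its proper submodules have strictly smaller [degP]. *)
have [L1 L1U maxL1] := @ksub_ex_min X (fun W => kle W U)
  (fun a b => - (lam * a%:R - b%:R)) U (kle_refl U).
have [L0 [L0U L0L1] minL0] := @ksub_ex_min X
  (fun W => kle W U /\ degP lam L1 <= degP lam W) (fun a b => (a + b)%N%:R) L1
  (conj L1U (lexx _)).
have PL0 : noP lam (kbot X) L0.
  move=> W _ WL0 sz; have WU := kle_trans WL0 L0U.
  rewrite ltNge; apply/negP => le.
  have := minL0 W (conj WU (le_trans L0L1 le)).
  by rewrite ler_nat -!/(ksize _) leqNgt sz.
have degL0 : 0 < degP lam L0.
  apply: lt_le_trans PU (le_trans _ L0L1).
  by have := maxL1 U (kle_refl U); rewrite lerN2.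
(* Dually, [L2] has minimal [degI] among the submodules above [L0], and [L] is a largest one
   reaching that value. *)
have [L2 L02 minL2] := @ksub_ex_min X (fun W => kle L0 W)
  (fun a b => (lam * b%:R - a%:R)) L0 (kle_refl L0).
have [L [L0L LL2] maxL] := @ksub_ex_min X
  (fun W => kle L0 W /\ degI lam W <= degI lam L2) (fun a b => - (a + b)%N%:R) L2
  (conj L02 (lexx _)).
have minL W : kle L0 W -> degI lam L <= degI lam W.
  by move=> L0W; apply: le_trans LL2 (minL2 _ L0W).
have L_top : noI lam L (ktop X).
  move=> W LW _ sz; rewrite ltNge; apply/negP => le.
  have := maxL W (conj (kle_trans L0L LW) (le_trans le LL2)).
  by rewrite lerN2 ler_nat -!/(ksize _) leqNgt sz.
have L0_mid W : kle L0 W -> kle W L ->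
    degP lam W <= degP lam L /\ ((ksize W < ksize L)%N -> degP lam W < degP lam L).
  move=> L0W WL; apply: degP_mono => //.
  by have := minL W L0W; rewrite /degI; lra.
exists L; split.
- rewrite lt0n; apply/eqP => L0s.
  have L00 : (ksize L0 <= ksize (kbot X))%N by rewrite (leq_trans (kle_size L0L)) ?L0s.
  have [p _] := deg_eq lam (kle_bot L0) L00.
  by have [z _] := deg_bot lam X; move: degL0; rewrite -p z ltxx.
(* If [L] were everything, the minimality of its [degI] would contradict the bound on [degI] of
   [U]. *)
- rewrite ltnNge; apply/negP => sz.
  have [_ e] := deg_eq lam (kle_top L) sz.
  by have := minL U L0U; rewrite e leNgt IU.
(* For [W] inside [L], modularity of [degP] reduces the comparison to [kadd W L0], which lies
   between [L0] and [L], and to [kcap W L0], which lies inside [L0]. *)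
- split; last by move=> W bW WL; apply: IX => //; apply: kle_top.
  move=> W _ WL sz.
  have [s1 s2] : kle L0 (kadd W L0) /\ kle (kadd W L0) L.
    by rewrite kle_addr kle_add WL.
  have [le lt] := L0_mid _ s1 s2.
  have := degP_cap lam W L0.
  have: (ksize (kcap W L0) < ksize L0)%N \/ (ksize L0 <= ksize (kcap W L0))%N.
    by case: ltnP => ?; [left | right].
  case=> [/(PL0 _ (kle_bot _) (kle_capr _ _)) h|h]; first by lra.
  have [p _] := deg_eq lam (kle_capr W L0) h.
  have [d1 d2] := kdim_cap W L0.
  have [h1 h2] := kle_dim (kle_capr W L0).
  have sz' : (ksize (kadd W L0) < ksize L)%N.
    by move: sz h d1 d2 h1 h2; rewrite /ksize; clear; lia.
  by have := lt sz'; lra.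
- by split=> // W LW Wt; apply: PX => //; apply: kle_bot.
Qed.

End Splitting.

(** * The shift functor *)

Section LinearFunctions.
Variable k : fieldType.

Lemma linfunE (aT rT : vectType k) (f : aT -> rT) :
  linear f -> linfun f =1 f.
Proof.
move=> lin; pose fl := HB.pack_for {linear aT -> rT} f
  (GRing.isLinear.Build _ _ _ _ _ lin).
exact: (lfunE fl).
Qed.

Lemma dim_limg_inj (aT rT : vectType k) (f : 'Hom(aT, rT)) U :
  lker f == 0%VS -> \dim (f @: U) = \dim U.
Proof. by move=> /eqP f0; apply: limg_dim_eq; rewrite f0 capv0. Qed.

Lemma dim_lpreim_inj (aT rT : vectType k) (f : 'Hom(aT, rT)) W :
  lker f == 0%VS -> (W <= limg f)%VS -> \dim (f @^-1: W) = \dim W.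
Proof. by move=> f0 /lpreimK {2}<-; rewrite dim_limg_inj. Qed.

End LinearFunctions.

Section Powers.
Variables (k : fieldType) (I : finType) (aT : vectType k).
Implicit Types V : {vspace aT}.

Definition ffincl V (w : {ffun I -> subvs_of V}) : {ffun I -> aT} :=
  [ffun i => vsval (w i)].

(** The power of [V] inside the power of [aT], given as the image of an injection so that its
    dimension can be read off. *)
Definition ffpow V : {vspace {ffun I -> aT}} := limg (linfun (@ffincl V)).

Lemma ffinclE V w : linfun (@ffincl V) w = ffincl w.
Proof.
by apply: linfunE => a u v; apply/ffunP => i; rewrite !ffunE linearP.
Qed.

Lemma mem_ffpow V (u : {ffun I -> aT}) : reflect (forall i, u i \in V) (u \in ffpow V).
Proof.
apply: (iffP memv_imgP) => [[w _ ->] i|uV].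
  by rewrite ffinclE ffunE subvsP.
exists [ffun i => vsproj V (u i)]; first exact: memvf.
by rewrite ffinclE; apply/ffunP => i; rewrite !ffunE vsprojK.
Qed.

Lemma dim_ffpow V : \dim (ffpow V) = (#|I| * \dim V)%N.
Proof.
rewrite dim_limg_inj ?dimvf //; apply/lker0P => u v.
rewrite !ffinclE => /ffunP uv; apply/ffunP => i.
by apply: subvs_inj; have := uv i; rewrite !ffunE.
Qed.

Lemma ffpow_full : ffpow fullv = fullv.
Proof.
apply/eqP; rewrite eqEsubv subvf; apply/subvP => u _; apply/mem_ffpow => i.
exact: memvf.
Qed.

End Powers.

Section Sigma.
Variables (k : fieldType) (n : nat).
Implicit Types X Y : krep k n.

Definition kact_fun X (u : {ffun 'I_n -> krep1 X}) : krep2 X :=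
  \sum_i karr X i (u i).
Definition kact X := linfun (@kact_fun X).

Lemma kactE X u : kact X u = \sum_i karr X i (u i).
Proof.
apply: linfunE => a v w; rewrite /kact_fun scaler_sumr -big_split.
by apply: eq_bigr => i _; rewrite !ffunE linearP.
Qed.

(** [ksat V] is the vertex-2 part of the submodule generated by [V]. The tuples in [krel V] become
    the vertex-1 part of a submodule of the shifted representation, with [V] at vertex 2. *)
Definition ksat X (V : {vspace krep1 X}) := (kact X @: ffpow 'I_n V)%VS.
Definition krel X (V : {vspace krep1 X}) := (ffpow 'I_n V :&: lker (kact X))%VS.

Lemma dim_krel X (V : {vspace krep1 X}) :
  (\dim (krel V) + \dim (ksat V) = n * \dim V)%N.
Proof. by rewrite limg_ker_dim dim_ffpow card_ord. Qed.

Lemma ksat_arr X (V : {vspace krep1 X}) i : (karr X i @: V <= ksat V)%VS.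
Proof.
apply/subvP => _ /memv_imgP[v vV ->]; apply/memv_imgP.
exists [ffun j => if j == i then v else 0].
  by apply/mem_ffpow => j; rewrite ffunE; case: eqP; rewrite ?mem0v.
rewrite kactE (bigD1 i) //= ffunE eqxx big1 ?addr0 // => j /negPf ji.
by rewrite ffunE ji linear0.
Qed.

Lemma ksat_min X (V : {vspace krep1 X}) (W : {vspace krep2 X}) :
  (forall i, karr X i @: V <= W)%VS -> (ksat V <= W)%VS.
Proof.
move=> h; apply/subvP => _ /memv_imgP[u /mem_ffpow uV ->].
by rewrite kactE memv_suml // => i _; apply: subvP (h i) _ (memv_img _ (uV i)).
Qed.

Definition gsub X (V : {vspace krep1 X}) : ksub X := KSub (@ksat_arr X V).

Lemma gsub_min X (U : ksub X) : (ksat (ksub1 U) <= ksub2 U)%VS.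
Proof. by apply: ksat_min => i; apply: ksubP. Qed.

Lemma ksatD X (V W : {vspace krep1 X}) : (ksat (V + W) <= ksat V + ksat W)%VS.
Proof.
by apply: ksat_min => i; rewrite limgD; apply: addvS; apply: ksat_arr.
Qed.

(* [Y] is the image of [X] under the shift functor sending [X] to
   [Ker (X_1^n -> X_2) <= X_1^n] with the [n] projections to [X_1]; applying
   it twice gives [tau]. *)
Definition is_sigma X Y := exists (j : 'Hom(krep1 Y, {ffun 'I_n -> krep1 X}))
    (phi : 'Hom(krep2 Y, krep1 X)),
  [/\ lker j == 0%VS, limg j = lker (kact X), lker phi == 0%VS,
      limg phi = fullv & forall i u, phi (karr Y i u) = j u i].

Lemma sigma_down X Y (V : {vspace krep1 X}) : is_sigma X Y ->
  exists W : ksub Y, kdim1 W = \dim (krel V) /\ kdim2 W = \dim V.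
Proof.
case=> j [phi [j0 jX phi0 phiX arrE]].
have subW i : (karr Y i @: (j @^-1: krel V) <= phi @^-1: V)%VS.
  apply/subvP => _ /memv_imgP[u uW ->]; rewrite -memv_preim arrE.
  by move: uW; rewrite -memv_preim => /memv_capP[/mem_ffpow].
exists (KSub subW); rewrite /kdim1 /kdim2 /= !dim_lpreim_inj ?phiX ?subvf //.
by rewrite jX capvSr.
Qed.

(** Converse to [sigma_down], up to an inequality: a submodule of [Y] sits inside the one attached
    to the image of its vertex-2 part in [krep1 X]. Two submodules are treated at once because
    [sigma_no_split] needs the two images to span [krep1 X] together. *)
Lemma sigma_up_sum X Y (U W : ksub Y) : is_sigma X Y ->
  (ksub2 U + ksub2 W)%VS = fullv -> exists A B : {vspace krep1 X},
  [/\ \dim A = kdim2 U, (kdim1 U <= \dim (krel A))%N,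
      \dim B = kdim2 W, (kdim1 W <= \dim (krel B))%N & (A + B)%VS = fullv].
Proof.
case=> j [phi [j0 jX phi0 phiX arrE]] UW.
exists (phi @: ksub2 U)%VS, (phi @: ksub2 W)%VS; rewrite !dim_limg_inj //.
have le (Z : ksub Y) : (kdim1 Z <= \dim (krel (phi @: ksub2 Z)))%N.
  rewrite /kdim1 -(dim_limg_inj _ j0); apply: dimvS.
  rewrite subv_cap -jX limgS ?subvf // andbT.
  apply/subvP => _ /memv_imgP[u uW ->]; apply/mem_ffpow => i.
  by rewrite -arrE memv_img // (subvP (ksubP Z i)) // memv_img.
by split=> //; rewrite -limgD UW.
Qed.

Lemma sigma_up X Y (W : ksub Y) : is_sigma X Y -> exists V : {vspace krep1 X},
  \dim V = kdim2 W /\ (kdim1 W <= \dim (krel V))%N.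
Proof.
move=> s; have [|A [B [dA A1 _ _ _]]] := @sigma_up_sum X Y W (ktop Y) s.
  exact: addvf.
by exists A.
Qed.

Lemma sigma_dim X Y : is_sigma X Y ->
  (kdim1 (ktop Y) + \dim (ksat (fullv : {vspace krep1 X})) = n * kdim1 (ktop X))%N
  /\ kdim2 (ktop Y) = kdim1 (ktop X).
Proof.
case=> j [phi [j0 jX phi0 phiX arrE]].
rewrite /kdim1 /kdim2 /= -(dim_limg_inj _ j0) jX -dim_krel /krel ffpow_full capfv.
by rewrite -(dim_limg_inj _ phi0) phiX.
Qed.

End Sigma.

(** * Slopes and decompositions under the shift functor *)

Section SigmaSlopes.
Variables (k : fieldType) (n : nat) (R : realFieldType) (lam : R).
Hypotheses (lam_gt1 : 1 < lam) (lamE : lam * lam + 1 = n%:R * lam).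
Implicit Types X Y : krep k n.

Notation full X := (fullv : {vspace krep1 X}).

Let natDR (a b c : nat) : (a + b)%N = c -> a%:R + b%:R = c%:R :> R.
Proof. by move=> <-; rewrite natrD. Qed.

Let natDMR (a b c : nat) : (a + b)%N = (n * c)%N -> a%:R + b%:R = n%:R * c%:R :> R.
Proof. by move=> /natDR ->; rewrite natrM. Qed.

Let natLR (a b : nat) : (a <= b)%N -> a%:R <= b%:R :> R.
Proof. by rewrite ler_nat. Qed.

(** By [lamE], the map (a, b) |-> (n a - b, a) multiplies [degP] by lam and divides [degI] by lam. A
    submodule [W] of [Y] is compared with the submodule [U] of [X] generated by its vertex-2 part:
    since the vertex-1 dimension of [W] is at most that of the shifted [U], [degP] of [W] is at most
    lam times that of [U], and [degI] of [W] is at least that of [U] divided by lam. *)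
Lemma sigma_nreg X Y : is_sigma X Y ->
  nreg lam (kbot X) (ktop X) -> nreg lam (kbot Y) (ktop Y).
Proof.
move=> s [PX IX].
have [y1 y2] := sigma_dim s.
(* [X] is generated at vertex 1: otherwise the submodule generated by [krep1 X] would be proper with
   a larger [degP]. *)
have satX : \dim (ksat (full X)) = kdim2 (ktop X).
  apply/eqP; rewrite eqn_leq dimvS ?subvf //= leqNgt; apply/negP => lt.
  have /(PX (gsub (full X)) (kle_bot _) (kle_top _)) :
      (ksize (gsub (full X)) < ksize (ktop X))%N.
    by move: lt; rewrite /ksize /kdim2 /kdim1 /=; clear; lia.
  have /natLR := ltnW lt.
  by rewrite /degP [kdim2 (gsub _)]/kdim2 [kdim1 (gsub _)]/kdim1 /=; lra.
rewrite satX in y1.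
have := natDMR y1 => ry1.
have l0 : 0 < lam := lt_trans ltr01 lam_gt1.
have step (W : ksub Y) : exists U : ksub X,
   [/\ kdim1 U = kdim2 W & (kdim1 W + kdim2 U <= n * kdim2 W)%N].
  have [V [dV le]] := sigma_up W s; exists (gsub V).
  rewrite [kdim1 (gsub _)]/kdim1 [kdim2 (gsub _)]/kdim2 /= dV.
  by rewrite -dV -dim_krel leq_add2r.
split=> W _ _ sz; have [U [d1 d2]] := step W.
- have [h1 h2] := kle_dim (kle_top W); have [e1 e2] := kle_dim (kle_top U).
  have /natLR := d2; rewrite natrD natrM => rd2.
  rewrite /degP y2.
  have {}ry1 : (kdim1 (ktop Y))%:R = n%:R * (kdim1 (ktop X))%:R - (kdim2 (ktop X))%:R :> R by lra.
  rewrite ry1.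
  have [lt|ge] := ltnP (ksize U) (ksize (ktop X)).
    have := PX U (kle_bot _) (kle_top _) lt; rewrite /degP d1.
    move: (kdim1 W)%:R (kdim2 W)%:R (kdim2 U)%:R (kdim1 (ktop X))%:R (kdim2 (ktop X))%:R rd2.
    move=> w1 w2 u2 x1 x2 rd2 h.
    have : 0 < lam * (lam * x1 - x2 - (lam * w2 - u2)) by apply: mulr_gt0; lra.
    have : 0 <= lam * (n%:R * w2 - w1 - u2) by apply: mulr_ge0; lra.
    have -> : lam * (n%:R * w2 - w1 - u2) = (n%:R * lam) * w2 - lam * w1 - lam * u2 by ring.
    have -> : lam * (n%:R * x1 - x2) = (n%:R * lam) * x1 - lam * x2 by ring.
    by rewrite -lamE; lra.
  (* Here [U] is all of [X], so [W] is full at vertex 2 and strictness comes from vertex 1. *)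
  have lt1 : (kdim1 W < kdim1 (ktop Y))%N.
    by move: sz ge h1 h2 e1 e2 d1 d2 y1 y2; rewrite /ksize; clear; lia.
  have e : kdim2 W = kdim1 (ktop X).
    by move: ge h1 h2 e1 e2 d1 d2 y1 y2; rewrite /ksize; clear; lia.
  rewrite e ltrD2r -ry1 ltr_pM2l // ltr_nat //.
- have [_ z] := deg_bot lam Y; rewrite z {z}.
  have [z1 z2] := kdim_bot X; have [z3 z4] := kdim_bot Y.
  have /IX : (ksize (kbot X) < ksize U)%N.
    by move: sz d1 d2; rewrite /ksize z1 z2 z3 z4; clear; case: (kdim2 W); lia.
  move=> /(_ (kle_bot _) (kle_top _)).
  have [_ z] := deg_bot lam X; rewrite z {z} /degI d1.
  have /natLR := d2; rewrite natrD natrM => rd2.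
  move: (kdim1 W)%:R (kdim2 W)%:R (kdim2 U)%:R rd2.
  move=> w1 w2 u2 rd2 h.
  have : 0 <= lam * (n%:R * w2 - w1 - u2) by apply: mulr_ge0; lra.
  have -> : lam * (n%:R * w2 - w1 - u2) = (n%:R * lam) * w2 - lam * w1 - lam * u2 by ring.
  rewrite -lamE -(pmulr_rgt0 _ l0); lra.
Qed.

(** A nonzero [X] concentrated at vertex 2 would have [degP] at most 0, violating [noP] against the
    zero submodule. Hence [krep1 X], which is isomorphic to [krep2 Y], is nonzero. *)
Lemma sigma_neq0 X Y : is_sigma X Y -> nreg lam (kbot X) (ktop X) ->
  (0 < ksize (ktop X))%N -> (0 < ksize (ktop Y))%N.
Proof.
move=> s [PX _] X0; have [_ y2] := sigma_dim s.
rewrite /ksize y2 addn_gt0 orbC lt0n; apply/orP; left; apply/eqP => x1.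
have /(PX _ (kle_bot _) (kle_top _)) : (ksize (kbot X) < ksize (ktop X))%N.
  by rewrite {1}/ksize; have [-> ->] := kdim_bot X.
have [-> _] := deg_bot lam X; rewrite /degP x1 mulr0 sub0r oppr_gt0.
by rewrite ltNge ler0n.
Qed.

(* Internal form of indecomposability, except that [X = 0] is allowed. *)
Definition no_split X := forall U V : ksub X, ksize (kcap U V) = 0%N ->
  (ksize U + ksize V = ksize (ktop X))%N -> ksize U = 0%N \/ ksize V = 0%N.

(* [X/U] is a nonzero quotient with a preprojective summand. *)
Definition badP X (U : ksub X) :=
  (ksize U < ksize (ktop X))%N /\ degP lam (ktop X) <= degP lam U.

(** The vertex-1 dimension of [X/U], the measure that drops along the orbit. *)
Definition corank1 X (U : ksub X) := (kdim1 (ktop X) - kdim1 U)%N.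

(** A complement of the span of the images of all arrows, placed at vertex 2, would split off. *)
Lemma no_split_sat X : no_split X -> (0 < kdim1 (ktop X))%N ->
  \dim (ksat (full X)) = kdim2 (ktop X).
Proof.
move=> iX x0; set S := ksat (full X).
have arr0 i : (karr X i @: 0 <= S^C)%VS by rewrite limg0 sub0v.
have [] := iX (gsub (full X)) (KSub arr0).
- by rewrite /ksize /kdim1 /kdim2 /= capv0 capv_compl !dimv0.
- rewrite /ksize /kdim1 /kdim2 /= dimv0 dimv_compl -/S.
  by have := dimvS (subvf S); clear; lia.
- by move: x0; rewrite /ksize /kdim1 /=; clear; lia.
rewrite /ksize /kdim1 /kdim2 /= dimv0 dimv_compl => e.
by apply/eqP; rewrite eqn_leq dimvS ?subvf //= -subn_eq0 -[X in X == _]add0n e.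
Qed.

(** A splitting of [Y] gives [A] and [B] spanning [krep1 X], with dimensions adding up to its
    dimension. The dimension formula for [Y] bounds the sum of the dimensions of [ksat A] and
    [ksat B] by that of [krep2 X], which they span, so [gsub A] and [gsub B] split [X]. *)
Lemma sigma_no_split X Y : is_sigma X Y -> no_split X ->
  \dim (ksat (full X)) = kdim2 (ktop X) -> no_split Y.
Proof.
move=> s iX satX U V cap0 sum.
have [y1 y2] := sigma_dim s; rewrite satX in y1.
have [c1 c2] := kdim_cap U V.
have [t1 t2] := kle_dim (kle_top (kadd U V)).
have z : kdim1 (kcap U V) = 0%N /\ kdim2 (kcap U V) = 0%N.
  by move: cap0; rewrite /ksize; clear; lia.
case: z => z1 z2.
have e1 : (kdim1 U + kdim1 V = kdim1 (ktop Y))%N.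
  by move: c1 c2 t1 t2 z1 z2 sum; rewrite /ksize; clear; lia.
have e2 : (kdim2 U + kdim2 V = kdim2 (ktop Y))%N.
  by move: c1 c2 t1 t2 z1 z2 sum; rewrite /ksize; clear; lia.
have UV : (ksub2 U + ksub2 V)%VS = fullv.
  apply/eqP; rewrite eqEdim subvf /=.
  by rewrite -/(kdim2 (kadd U V)) -/(kdim2 (ktop Y)) -e2 -c2 z2 addn0.
have [A [B [dA A1 dB B1 AB]]] := sigma_up_sum s UV.
have rA := dim_krel A; have rB := dim_krel B.
have sAB : (ksat A + ksat B)%VS = fullv.
  apply/eqP; rewrite eqEdim subvf /= -/(kdim2 (ktop X)) -satX -AB.
  exact/dimvS/ksatD.
have d1 := dimv_sum_cap A B; have d2 := dimv_sum_cap (ksat A) (ksat B).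
rewrite AB -/(kdim1 (ktop X)) in d1; rewrite sAB -/(kdim2 (ktop X)) in d2.
have ns : (n * (kdim2 U + kdim2 V) = n * kdim2 (ktop Y))%N by rewrite e2.
rewrite mulnDr y2 in ns; rewrite dA in rA; rewrite dB in rB.
have cs : \dim (A :&: B) = 0%N /\ \dim (ksat A :&: ksat B) = 0%N.
  by move: d1 d2 ns rA rB e1 e2 A1 B1 y1 y2; rewrite dA dB; clear; lia.
case: cs => cs1 cs2.
have small (Z : ksub Y) (C : {vspace krep1 X}) : \dim C = kdim2 Z ->
    (kdim1 Z <= \dim (krel C))%N -> \dim C = 0%N -> ksize Z = 0%N.
  move=> dC le C0; have := dim_krel C.
  by move: dC le; rewrite /ksize C0; clear; lia.
have [] := iX (gsub A) (gsub B).
- by rewrite /ksize /kdim1 /kdim2 /= cs1 cs2.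
- move: d1 d2; rewrite /ksize ![kdim1 (gsub _)]/kdim1 ![kdim2 (gsub _)]/kdim2 /= cs1 cs2.
  by clear; lia.
- move=> /eqP; rewrite addn_eq0 => /andP[/eqP A0 _]; left; exact: small A1 A0.
- move=> /eqP; rewrite addn_eq0 => /andP[/eqP B0 _]; right; exact: small B1 B0.
Qed.

Lemma kdim1_ltn_top X (U : ksub X) :
  \dim (ksat (full X)) = kdim2 (ktop X) -> (ksize U < ksize (ktop X))%N ->
  (kdim1 U < kdim1 (ktop X))%N.
Proof.
move=> satX sz; have [t1 t2] := kle_dim (kle_top U).
rewrite ltn_neqAle t1 andbT; apply/eqP => e.
have U1 : ksub1 U = fullv by apply/eqP; rewrite eqEdim subvf -/(kdim1 U) e /=.
have /dimvS := gsub_min U; rewrite U1 satX -/(kdim2 U).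
by move: sz e; rewrite /ksize; clear; lia.
Qed.

(** Let (a, b) be the dimension vector of [X] modulo the submodule generated by [ksub1 U]. Badness
    gives lam a <= b, and the shift only scales the difference of [degP] by lam, so badness
    persists. The new corank is n a - b <= (n - lam) a = a / lam < a. *)
Lemma sigma_badP X Y (U : ksub X) : is_sigma X Y -> no_split X -> badP U ->
  ksize (ktop Y) = 0%N \/
  no_split Y /\ exists2 W : ksub Y, badP W & (corank1 W < corank1 U)%N.
Proof.
move=> s iX [szU degU].
have [y1 y2] := sigma_dim s.
have [x0|xp] := posnP (kdim1 (ktop X)).
  by left; rewrite /ksize y2; move: y1; rewrite x0; clear; lia.
right; have satX := no_split_sat iX xp; split; first exact: sigma_no_split iX satX.
have [W [w1 w2]] := sigma_down (ksub1 U) s.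
have := dim_krel (ksub1 U); rewrite -w1 -/(kdim1 U) => rU.
have /dimvS := gsub_min U; rewrite -/(kdim2 U) => /natLR le.
rewrite -/(kdim1 U) in w2; have [t1 t2] := kle_dim (kle_top U).
have [q1 q2] := kle_dim (kle_top W).
rewrite satX in y1; have u1 := kdim1_ltn_top satX szU.
have ry1 := natDMR y1; have rw1 := natDMR rU.
have l0 : 0 < lam := lt_trans ltr01 lam_gt1.
have lu1 : (kdim1 U)%:R < (kdim1 (ktop X))%:R :> R by rewrite ltr_nat.
exists W; first split.
- by move: q1 q2 u1 y2 w2; rewrite /ksize; clear; lia.
- move: degU; rewrite /degP y2 w2.
  move: (kdim1 W)%:R (kdim1 U)%:R (kdim2 U)%:R (kdim1 (ktop X))%:R
    (kdim2 (ktop X))%:R (kdim1 (ktop Y))%:R (\dim (ksat (ksub1 U)))%:R ry1 rw1 le.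
  move=> a1 b1 b2 x1 x2 c1 t ry1 rw1 le degU.
  have -> : c1 = n%:R * x1 - x2 by lra.
  have -> : a1 = n%:R * b1 - t by lra.
  have : 0 <= lam * (lam * b1 - t - (lam * x1 - x2)) by apply: mulr_ge0; lra.
  have -> : lam * (n%:R * b1 - t) = (n%:R * lam) * b1 - lam * t by ring.
  have -> : lam * (n%:R * x1 - x2) = (n%:R * lam) * x1 - lam * x2 by ring.
  by rewrite -lamE; lra.
- rewrite /corank1 -(ltr_nat R) !natrB //.
  move: degU lu1; rewrite /degP.
  move: (kdim1 W)%:R (kdim1 U)%:R (kdim2 U)%:R (kdim1 (ktop X))%:R
    (kdim2 (ktop X))%:R (kdim1 (ktop Y))%:R (\dim (ksat (ksub1 U)))%:R ry1 rw1 le.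
  move=> a1 b1 b2 x1 x2 c1 t ry1 rw1 le degU lu1.
  have h : 0 < (lam - 1) * (x1 - b1) by apply: mulr_gt0; rewrite subr_gt0.
  have -> : c1 = n%:R * x1 - x2 by lra.
  have -> : a1 = n%:R * b1 - t by lra.
  have h2 : 0 <= lam * (lam * b1 - t - (lam * x1 - x2)) by apply: mulr_ge0; lra.
  rewrite -(ltr_pM2l l0).
  have -> : lam * (n%:R * x1 - x2 - (n%:R * b1 - t)) =
      (n%:R * lam) * (x1 - b1) - lam * (x2 - t) by ring.
  by rewrite -lamE; lra.
Qed.

End SigmaSlopes.

(** * The translation and the duality *)

Section Tau.
Variables (k : fieldType) (n : nat).
Implicit Types X Y : krep k n.

Definition sigma_arr X i (w : subvs_of (lker (nu_res2 X))) : krep1 X := vsval w i.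

(** The vertex-1 space is the kernel of [nu_res2 X], literally the vertex-2 space of [tau X], so the
    comparison map there in [is_sigma_tau] is the identity. *)
Definition sigma X : krep k n := KRep (fun i => linfun (@sigma_arr X i)).

Lemma sigma_arrE X i w : karr (sigma X) i w = vsval w i.
Proof.
by apply: linfunE => a u v; rewrite /sigma_arr linearP /= !ffunE.
Qed.

Lemma lker_nu_res2 X : lker (nu_res2 X) = lker (kact X).
Proof.
apply/vspaceP => v; rewrite !memv_ker nu_res2E kactE.
by rewrite -pair_eqE /= /pair_eq /= eqxx.
Qed.

Lemma is_sigma_sigma X : is_sigma X (sigma X).
Proof.
exists (linfun vsval), \1%VF; split.
- by apply/lker0P => u v; rewrite !lfunE => /subvs_inj.
- apply/vspaceP => v; rewrite -lker_nu_res2; apply/memv_imgP/idP => [[u _ ->]|vK].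
    by rewrite lfunE subvsP.
  by exists (vsproj _ v); rewrite ?memvf // lfunE /= vsprojK.
- by apply/lker0P => u v; rewrite !id_lfunE.
- by rewrite lim1g.
- by move=> i u; rewrite id_lfunE sigma_arrE lfunE.
Qed.

Definition tau_incl X (w : krep1 (tau X)) :
    {ffun 'I_n -> subvs_of (lker (nu_res2 X))} :=
  [ffun i => vsproj _ (vsval w i)].

Lemma tau_inclE X w : linfun (@tau_incl X) w = tau_incl w.
Proof.
apply: linfunE => a u v; apply/ffunP => i; rewrite !ffunE -linearP.
by congr (vsproj _ _); rewrite !ffunE.
Qed.

Lemma tau_ker X (w : {ffun 'I_n -> {ffun 'I_n -> krep1 X}}) :
  (w \in lker (nu_res1 X)) =
  (\sum_i w i i == 0) && [forall i, w i \in lker (nu_res2 X)].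
Proof.
rewrite memv_ker nu_res1E -pair_eqE /= /pair_eq /=; congr (_ && _).
apply/eqP/forallP => [/ffunP h i|h].
  by rewrite lker_nu_res2 memv_ker kactE; have := h i; rewrite !ffunE => ->.
by apply/ffunP => i; have := h i; rewrite lker_nu_res2 memv_ker kactE !ffunE => /eqP.
Qed.

(** A kernel element of [nu_res1 X] is a tuple of vectors [w i] of [sigma X] at vertex 1 for which
    the sum of the [w i i] vanishes. As the i-th arrow of [sigma X] is the i-th projection, that sum
    is the total action on [sigma X]. *)
Lemma is_sigma_tau X : is_sigma (sigma X) (tau X).
Proof.
have wK (w : krep1 (tau X)) i : vsval (vsproj (lker (nu_res2 X)) (vsval w i)) = vsval w i.
  by rewrite vsprojK //; have := subvsP w; rewrite tau_ker => /andP[_ /forallP].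
exists (linfun (@tau_incl X)), \1%VF; split.
- apply/lker0P => u v; rewrite !tau_inclE => /ffunP uv; apply/subvs_inj/ffunP => i.
  by have := uv i; rewrite !ffunE => /(congr1 vsval); rewrite !wK.
- apply/vspaceP => z; rewrite memv_ker kactE; apply/memv_imgP/idP => [[u _ ->]|zK].
    have := subvsP u; rewrite tau_ker => /andP[/eqP s0 _]; apply/eqP.
    by rewrite -[RHS]s0; apply: eq_bigr => i _; rewrite sigma_arrE tau_inclE ffunE wK.
  pose w : {ffun 'I_n -> {ffun 'I_n -> krep1 X}} := [ffun i => vsval (z i)].
  have wker : w \in lker (nu_res1 X).
    rewrite tau_ker; apply/andP; split; last first.
      by apply/forallP => i; rewrite ffunE subvsP.
    by rewrite -[X in _ == X](eqP zK); apply/eqP; apply: eq_bigr => i _; rewrite sigma_arrE ffunE.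
  exists (vsproj (lker (nu_res1 X)) w : krep1 (tau X)); first exact: memvf.
  rewrite tau_inclE; apply/ffunP => i; rewrite ffunE vsprojK //.
  by rewrite ffunE vsvalK.
- by apply/lker0P => u v; rewrite !id_lfunE.
- by rewrite lim1g.
- move=> i u; rewrite id_lfunE tau_inclE ffunE.
  by rewrite lfunE /= inj2_arrE.
Qed.

End Tau.

(** * Annihilators in the dual space *)

Section Annihilators.
Variables (k : fieldType) (vT : vectType k).
Notation dual := 'Hom(vT, k^o).

Definition perp_fun (V : {vspace vT}) (f : dual) : 'Hom(subvs_of V, k^o) :=
  (f \o linfun vsval)%VF.
Definition perp (V : {vspace vT}) : {vspace dual} := lker (linfun (perp_fun V)).

Definition ann_fun (W : {vspace dual}) (v : vT) : 'Hom(subvs_of W, k^o) :=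
  linfun (fun f : subvs_of W => vsval f v).
Definition ann (W : {vspace dual}) : {vspace vT} := lker (linfun (ann_fun W)).

Lemma perp_funE V f : linfun (perp_fun V) f = perp_fun V f.
Proof.
by apply: linfunE => a u v; rewrite /perp_fun comp_lfunDl comp_lfunZl.
Qed.

Lemma ann_fun_eval W v f : ann_fun W v f = vsval f v.
Proof.
by apply: linfunE => a u w; rewrite linearP /= add_lfunE scale_lfunE.
Qed.

Lemma ann_funE W v : linfun (ann_fun W) v = ann_fun W v.
Proof.
apply: linfunE => a u w; apply/lfunP => f.
by rewrite add_lfunE scale_lfunE !ann_fun_eval linearP.
Qed.

Lemma mem_perp (V : {vspace vT}) (f : dual) : reflect (forall v, v \in V -> f v = 0) (f \in perp V).
Proof.
rewrite memv_ker perp_funE; apply: (iffP eqP) => [/lfunP h v vV|h].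
  by have := h (vsproj V v); rewrite comp_lfunE lfunE /= vsprojK // => ->; rewrite lfunE.
by apply/lfunP => v; rewrite comp_lfunE !lfunE /= h ?subvsP.
Qed.

Lemma mem_ann (W : {vspace dual}) (v : vT) : reflect (forall f, f \in W -> f v = 0) (v \in ann W).
Proof.
rewrite memv_ker ann_funE; apply: (iffP eqP) => [/lfunP h f fW|h].
  by have := h (vsproj W f); rewrite ann_fun_eval vsprojK // => ->; rewrite lfunE.
by apply/lfunP => f; rewrite ann_fun_eval h ?subvsP // lfunE.
Qed.

Lemma dim_dual (aT : vectType k) : \dim {: 'Hom(aT, k^o)} = \dim {: aT}.
Proof. by rewrite !dimvf /dim /= muln1. Qed.

Lemma dim_perp (V : {vspace vT}) : (\dim (perp V) + \dim V = \dim {: vT})%N.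
Proof.
rewrite -(dim_dual vT) -(limg_ker_dim (linfun (perp_fun V)) fullv) capfv.
congr addn; suff -> : limg (linfun (perp_fun V)) = fullv by rewrite dim_dual !dimvf.
apply/eqP; rewrite eqEsubv subvf; apply/subvP => g _; apply/memv_imgP.
exists (g \o linfun (vsproj V))%VF; first exact: memvf.
rewrite perp_funE; apply/lfunP => v; rewrite !comp_lfunE !lfunE /=.
by rewrite vsvalK.
Qed.

(** One inequality comes from [W] lying in [perp (ann W)], the other from rank-nullity for
    evaluation on [W]. *)
Lemma dim_ann (W : {vspace dual}) : (\dim (ann W) + \dim W = \dim {: vT})%N.
Proof.
apply/eqP; rewrite eqn_leq; apply/andP; split.
  rewrite -(dim_perp (ann W)) addnC leq_add2r; apply/dimvS/subvP => f fW.
  by apply/mem_perp => v /mem_ann; apply.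
rewrite -(limg_ker_dim (linfun (ann_fun W)) fullv) capfv leq_add2l.
by rewrite (leq_trans (dimvS (subvf _))) // dim_dual !dimvf.
Qed.

End Annihilators.

Section Duality.
Variables (k : fieldType) (n : nat) (R : realFieldType) (lam : R).
Implicit Types X Y : krep k n.

Lemma kdual_arrE X i f : karr (kdual X) i f = (f \o karr X i)%VF.
Proof.
by apply: linfunE => a u v; rewrite comp_lfunDl comp_lfunZl.
Qed.

Fact dsubP X (U : ksub X) i :
  (karr (kdual X) i @: perp (ksub2 U) <= perp (ksub1 U))%VS.
Proof.
apply/subvP => _ /memv_imgP[f /mem_perp fU ->]; rewrite kdual_arrE.
apply/mem_perp => v vU; rewrite comp_lfunE fU //.
by apply: subvP (ksubP U i) _ (memv_img _ vU).
Qed.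
Definition dsub X (U : ksub X) : ksub (kdual X) := KSub (dsubP U).

Fact asubP X (W : ksub (kdual X)) i :
  (karr X i @: ann (ksub2 W) <= ann (ksub1 W))%VS.
Proof.
apply/subvP => _ /memv_imgP[v /mem_ann vW ->].
apply/mem_ann => f fW; rewrite -comp_lfunE -kdual_arrE vW //.
by apply: subvP (ksubP W i) _ (memv_img _ fW).
Qed.
Definition asub X (W : ksub (kdual X)) : ksub X := KSub (asubP W).

Lemma dim_dsub X (U : ksub X) :
  (kdim1 (dsub U) + kdim2 U = kdim2 (ktop X))%N /\
  (kdim2 (dsub U) + kdim1 U = kdim1 (ktop X))%N.
Proof. by split; apply: dim_perp. Qed.

Lemma dim_asub X (W : ksub (kdual X)) :
  (kdim1 (asub W) + kdim2 W = kdim1 (ktop X))%N /\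
  (kdim2 (asub W) + kdim1 W = kdim2 (ktop X))%N.
Proof. by split; apply: dim_ann. Qed.

Lemma dim_kdual X : kdim1 (ktop (kdual X)) = kdim2 (ktop X) /\
  kdim2 (ktop (kdual X)) = kdim1 (ktop X).
Proof. by split; apply: dim_dual. Qed.

Lemma size_kdual X : ksize (ktop (kdual X)) = ksize (ktop X).
Proof. by rewrite /ksize; have [-> ->] := dim_kdual X; rewrite addnC. Qed.

Lemma kdual_nreg X :
  nreg lam (kbot X) (ktop X) -> nreg lam (kbot (kdual X)) (ktop (kdual X)).
Proof.
have [e1 e2] := dim_kdual X.
have [z1 z2] := kdim_bot X; have [z3 z4] := kdim_bot (kdual X).
apply: nreg_dual; rewrite ?e1 ?e2 ?z1 ?z2 ?z3 ?z4 // => W _ _.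
by have [d1 d2] := dim_asub W; exists (asub W); rewrite kle_top kle_bot !addn0; split.
Qed.

(** A splitting of the dual is pulled back by annihilators: the intersection of [asub U] and
    [asub V] lies in the annihilator of [kadd U V], which is zero. *)
Lemma kdual_no_split X : no_split X -> no_split (kdual X).
Proof.
move=> iX U V cap0 sum.
have [e1 e2] := dim_kdual X.
have [t1 t2] := kle_dim (kle_top (kadd U V)).
have [c1 c2] := kdim_cap U V.
have [a1 a2] := dim_asub U; have [b1 b2] := dim_asub V.
have : kle (kcap (asub U) (asub V)) (asub (kadd U V)).
  rewrite /kle /=; apply/andP; split; apply/subvP => v /memv_capP[/mem_ann vU /mem_ann vV];
  apply/mem_ann => _ /memv_addP[f fU [g gV ->]];
  by rewrite add_lfunE vU // vV // addr0.
move=> /kle_dim[s1 s2]; have [d1 d2] := dim_asub (kadd U V).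
have [] := iX (asub U) (asub V).
- move: cap0 sum t1 t2 c1 c2 s1 s2 d1 d2; rewrite /ksize e1 e2; clear; lia.
- move: cap0 sum t1 t2 c1 c2 a1 a2 b1 b2; rewrite /ksize e1 e2; clear; lia.
- by move: cap0 sum t1 t2 c1 c2 a1 a2 b1 b2; rewrite /ksize e1 e2; clear; lia.
- by move: cap0 sum t1 t2 c1 c2 a1 a2 b1 b2; rewrite /ksize e1 e2; clear; lia.
Qed.

(* [U] is nonzero and has a preinjective summand. *)
Definition badI X (U : ksub X) := (0 < ksize U)%N /\ degI lam U <= 0.

Let natDR (a b c : nat) : (a + b)%N = c -> c%:R = a%:R + b%:R :> R.
Proof. by move=> <-; rewrite natrD. Qed.

Lemma dsub_badP X (U : ksub X) : badI U -> badP lam (dsub U) /\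
  corank1 (dsub U) = kdim2 U.
Proof.
move=> [sz deg]; have [e1 e2] := dim_kdual X; have [d1 d2] := dim_dsub U.
split; last by rewrite /corank1 e1 -d1 addnC addnK.
split.
  by move: sz d1 d2; rewrite [ksize (ktop _)]/ksize e1 e2 /ksize; clear; lia.
by move: deg; rewrite /degP /degI e1 e2 (natDR d1) (natDR d2); lra.
Qed.

Lemma dsub_badI X (U : ksub X) : badP lam U -> badI (dsub U) /\
  kdim2 (dsub U) = corank1 U.
Proof.
move=> [sz deg]; have [d1 d2] := dim_dsub U.
split; last by rewrite /corank1 -d2 addnK.
split.
  by move: sz d1 d2; rewrite /ksize; clear; lia.
by move: deg; rewrite /degP /degI (natDR d1) (natDR d2); lra.
Qed.

End Duality.

(** * Transport along morphisms *)

Section Transport.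
Variables (k : fieldType) (n : nat).
Implicit Types X Y : krep k n.

Lemma is_zeroE X : is_zero X <-> ksize (ktop X) = 0%N.
Proof.
rewrite /is_zero /dimvec /ksize /kdim1 /kdim2 /=.
by split=> [[-> ->]//|/eqP]; rewrite addn_eq0 => /andP[/eqP-> /eqP->].
Qed.

Lemma khom_arr X Y (h : khom X Y) i v :
  khom2 h (karr X i v) = karr Y i (khom1 h v).
Proof. by rewrite -!comp_lfunE khomP. Qed.

Fact kimgP X Y (h : khom X Y) (W : ksub X) i :
  (karr Y i @: (khom1 h @: ksub1 W) <= khom2 h @: ksub2 W)%VS.
Proof.
apply/subvP => _ /memv_imgP[_ /memv_imgP[w wW ->] ->].
by rewrite -khom_arr memv_img // (subvP (ksubP W i)) // memv_img.
Qed.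
Definition kimg X Y (h : khom X Y) (W : ksub X) : ksub Y := KSub (kimgP h W).

Fact kpreimP X Y (h : khom X Y) (W : ksub Y) i :
  (karr X i @: (khom1 h @^-1: ksub1 W) <= khom2 h @^-1: ksub2 W)%VS.
Proof.
apply/subvP => _ /memv_imgP[v vW ->]; rewrite -memv_preim in vW.
by rewrite -memv_preim khom_arr (subvP (ksubP W i)) // memv_img.
Qed.
Definition kpreim X Y (h : khom X Y) (W : ksub Y) : ksub X := KSub (kpreimP h W).

Definition kinj X Y (h : khom X Y) :=
  lker (khom1 h) == 0%VS /\ lker (khom2 h) == 0%VS.

Lemma dim_kimg X Y (h : khom X Y) (W : ksub X) : kinj h ->
  kdim1 (kimg h W) = kdim1 W /\ kdim2 (kimg h W) = kdim2 W.
Proof. by case=> h1 h2; split; apply: dim_limg_inj. Qed.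

Lemma kle_kimg X Y (h : khom X Y) (U W : ksub X) :
  kle U W -> kle (kimg h U) (kimg h W).
Proof. by case/andP=> a b; rewrite /kle !limgS. Qed.

Lemma dim_kpreim_inj X Y (h : khom X Y) (W : ksub Y) : kinj h ->
  kle W (kimg h (ktop X)) ->
  kdim1 (kpreim h W) = kdim1 W /\ kdim2 (kpreim h W) = kdim2 W.
Proof. by case=> h1 h2 /andP[l1 l2]; split; apply: dim_lpreim_inj. Qed.

Lemma size_cap X (U V : ksub X) :
  (ksize (kadd U V) + ksize (kcap U V) = ksize U + ksize V)%N.
Proof. by have [] := kdim_cap U V; rewrite /ksize; clear; lia. Qed.

Lemma cap_kimg0 X Y (h : khom X Y) (U V : ksub X) : kinj h ->
  ksize (kcap U V) = 0%N -> ksize (kcap (kimg h U) (kimg h V)) = 0%N.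
Proof.
case=> h1 h2; rewrite /ksize /kdim1 /kdim2 /= -!lker0_img_cap //.
by rewrite !dim_limg_inj.
Qed.

Lemma linfun_vsval_ker (vT : vectType k) (U : {vspace vT}) :
  lker (linfun (vsval : subvs_of U -> vT)) == 0%VS.
Proof. by apply/lker0P => u v; rewrite !lfunE => /subvs_inj. Qed.

Lemma linfun_vsval_img (vT : vectType k) (U : {vspace vT}) :
  limg (linfun (vsval : subvs_of U -> vT)) = U.
Proof.
apply/vspaceP => v; apply/memv_imgP/idP => [[u _ ->]|vU].
  by rewrite lfunE subvsP.
by exists (vsproj U v); rewrite ?memvf // lfunE /= vsprojK.
Qed.

Lemma krep_of_sub_arr X (U : ksub X) i w :
  vsval (karr (krep_of_sub U) i w) = karr X i (vsval w).
Proof.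
rewrite lfunE /= vsprojK // (subvP (ksubP U i)) // memv_img //.
exact: subvsP.
Qed.

Lemma vsval_lfunE (vT : vectType k) (U : {vspace vT}) (w : subvs_of U) :
  linfun vsval w = vsval w.
Proof. exact: lfunE. Qed.

Fact sub_inclP X (U : ksub X) i :
  ((linfun vsval : 'Hom(krep2 (krep_of_sub U), krep2 X)) \o karr (krep_of_sub U) i =
   karr X i \o (linfun vsval : 'Hom(krep1 (krep_of_sub U), krep1 X)))%VF.
Proof.
apply/lfunP => v; rewrite !comp_lfunE.
rewrite (vsval_lfunE (karr (krep_of_sub U) i v)) (vsval_lfunE (v : subvs_of (ksub1 U))).
exact: krep_of_sub_arr.
Qed.
Definition sub_incl X (U : ksub X) : khom (krep_of_sub U) X := KHom (sub_inclP U).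

Lemma sub_incl_inj X (U : ksub X) : kinj (sub_incl U).
Proof. by split; apply: linfun_vsval_ker. Qed.

Lemma sub_incl_img X (U : ksub X) :
  kle (kimg (sub_incl U) (ktop _)) U /\ kle U (kimg (sub_incl U) (ktop _)).
Proof. by rewrite /kle /= !linfun_vsval_img !subvv. Qed.

Lemma dim_krep_of_sub X (U : ksub X) :
  kdim1 (ktop (krep_of_sub U)) = kdim1 U /\ kdim2 (ktop (krep_of_sub U)) = kdim2 U.
Proof. by rewrite /kdim1 /kdim2 /= !dimvf. Qed.

Lemma size_krep_of_sub X (U : ksub X) : ksize (ktop (krep_of_sub U)) = ksize U.
Proof. by rewrite /ksize; have [-> ->] := dim_krep_of_sub U. Qed.

Lemma bijK (aT rT : vectType k) (f : 'Hom(aT, rT)) :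
  limg f = fullv -> cancel f^-1%VF f.
Proof. by move=> fX v; rewrite limg_lfunVK // fX memvf. Qed.

Definition inl_lfun (U V : vectType k) : 'Hom(U, (U * V)%type) :=
  linfun (fun u : U => (u, 0 : V)).
Definition inr_lfun (U V : vectType k) : 'Hom(V, (U * V)%type) :=
  linfun (fun v : V => (0 : U, v)).

Lemma inl_lfunE U V u : inl_lfun U V u = (u, 0).
Proof. by apply: linfunE => c a b; congr pair; rewrite /= ?scaler0 ?addr0. Qed.

Lemma inr_lfunE U V v : inr_lfun U V v = (0, v).
Proof. by apply: linfunE => c a b; congr pair; rewrite /= ?scaler0 ?addr0. Qed.

Lemma ksum_incl X A B : kiso X (ksum A B) ->
  exists (a : khom A X) (b : khom B X), [/\ kinj a, kinj b,
    ksize (kcap (kimg a (ktop A)) (kimg b (ktop B))) = 0%N &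
    (kdim1 (ktop A) + kdim1 (ktop B) = kdim1 (ktop X))%N /\
    (kdim2 (ktop A) + kdim2 (ktop B) = kdim2 (ktop X))%N].
Proof.
case=> f [[f1 f2] [F1 F2]].
have aP i : (((khom2 f)^-1 \o inl_lfun (krep2 A) (krep2 B)) \o karr A i =
    karr X i \o ((khom1 f)^-1 \o inl_lfun (krep1 A) (krep1 B)))%VF.
  apply/lfunP => v; apply: f2; rewrite !comp_lfunE khom_arr (bijK F2) (bijK F1).
  by rewrite !inl_lfunE ksum_arrE /= linear0.
have bP i : (((khom2 f)^-1 \o inr_lfun (krep2 A) (krep2 B)) \o karr B i =
    karr X i \o ((khom1 f)^-1 \o inr_lfun (krep1 A) (krep1 B)))%VF.
  apply/lfunP => v; apply: f2; rewrite !comp_lfunE khom_arr (bijK F2) (bijK F1).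
  by rewrite !inr_lfunE ksum_arrE /= linear0.
exists (KHom aP), (KHom bP); split.
- split; apply/lker0P => u v; rewrite /= !comp_lfunE.
    by move/(congr1 (khom1 f)); rewrite !(bijK F1) !inl_lfunE => [[]].
  by move/(congr1 (khom2 f)); rewrite !(bijK F2) !inl_lfunE => [[]].
- split; apply/lker0P => u v; rewrite /= !comp_lfunE.
    by move/(congr1 (khom1 f)); rewrite !(bijK F1) !inr_lfunE => [[]].
  by move/(congr1 (khom2 f)); rewrite !(bijK F2) !inr_lfunE => [[]].
- apply/eqP; rewrite /ksize addn_eq0 /kdim1 /kdim2 !dimv_eq0 /= -!subv0.
  apply/andP; split; apply/subvP => _ /memv_capP[/memv_imgP[u _ ->] /memv_imgP[v _]];
  rewrite /= !comp_lfunE memv0.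
    move=> /(congr1 (khom1 f)); rewrite !(bijK F1) inl_lfunE inr_lfunE => [[-> _]].
    by rewrite linear0.
  move=> /(congr1 (khom2 f)); rewrite !(bijK F2) inl_lfunE inr_lfunE => [[-> _]].
  by rewrite linear0.
- move/lker0P in f1; move/lker0P in f2.
  split; rewrite /kdim1 /kdim2 /=.
    by rewrite -(dim_limg_inj _ f1) F1 !dimvf.
  by rewrite -(dim_limg_inj _ f2) F2 !dimvf.
Qed.

Definition split_sub X (U V : ksub X) :=
  ksize (kcap U V) = 0%N /\ (ksize U + ksize V = ksize (ktop X))%N.

Lemma daddv_pi_sum (vT : vectType k) (U V : {vspace vT}) u v :
  (U :&: V = 0)%VS -> u \in U -> v \in V -> daddv_pi U V (u + v) = u.
Proof.
move=> UV uU vV; rewrite linearD /= daddv_pi_id //.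
have VU : (V :&: U = 0)%VS by rewrite capvC.
have := daddv_pi_add UV (subvP (addvSr U V) _ vV); rewrite (daddv_pi_id VU vV).
by rewrite -[X in _ = X]add0r => /addIr ->; rewrite addr0.
Qed.

Definition split_fun (vT : vectType k) (U V : {vspace vT}) (v : vT) :
    subvs_of U * subvs_of V :=
  (vsproj U (daddv_pi U V v), vsproj V (daddv_pi V U v)).

Lemma split_funE vT U V v : linfun (@split_fun vT U V) v = split_fun U V v.
Proof. by apply: linfunE => c a b; congr pair; rewrite !linearP. Qed.

Lemma split_fun_sum vT (U V : {vspace vT}) (u : subvs_of U) (v : subvs_of V) :
  (U :&: V = 0)%VS -> split_fun U V (vsval u + vsval v) = (u, v).
Proof.
move=> UV; have VU : (V :&: U = 0)%VS by rewrite capvC.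
rewrite /split_fun daddv_pi_sum ?subvsP // [vsval u + _]addrC.
by rewrite daddv_pi_sum ?subvsP // !vsvalK.
Qed.

Lemma split_ex (vT : vectType k) (U V : {vspace vT}) (w : vT) : (U + V)%VS = fullv ->
  exists (u : subvs_of U) (v : subvs_of V), w = vsval u + vsval v.
Proof.
move=> UV; have : w \in (U + V)%VS by rewrite UV memvf.
case/memv_addP=> u uU [v vV ->]; exists (vsproj U u), (vsproj V v).
by rewrite !vsprojK.
Qed.

Lemma split_fun_bij (vT : vectType k) (U V : {vspace vT}) : (U :&: V = 0)%VS ->
  (U + V)%VS = fullv ->
  injective (linfun (@split_fun vT U V)) /\ limg (linfun (@split_fun vT U V)) = fullv.
Proof.
move=> UV0 UV; split.
  move=> w w'; have [u [v ->]] := split_ex w UV; have [u' [v' ->]] := split_ex w' UV.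
  by rewrite !split_funE !split_fun_sum // => [[-> ->]].
apply/eqP; rewrite eqEsubv subvf; apply/subvP => [[u v] _]; apply/memv_imgP.
by exists (vsval u + vsval v); rewrite ?memvf // split_funE split_fun_sum.
Qed.

Lemma split_subE X (U V : ksub X) : split_sub U V ->
  [/\ (ksub1 U :&: ksub1 V = 0)%VS, (ksub1 U + ksub1 V = fullv)%VS,
      (ksub2 U :&: ksub2 V = 0)%VS & (ksub2 U + ksub2 V = fullv)%VS].
Proof.
case=> cap sum; have s := size_cap U V.
have [|e1 e2] := kle_eq (kle_top (kadd U V)); first by rewrite -sum -s cap addn0.
move/eqP: cap; rewrite /ksize addn_eq0 /kdim1 /kdim2 !dimv_eq0 => /andP[/eqP c1 /eqP c2].
by split.
Qed.

Lemma summand_split X (U V : ksub X) :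
  split_sub U V -> direct_summand (krep_of_sub U) X.
Proof.
move=> /split_subE[c1 s1 c2 s2]; exists (krep_of_sub V).
pose f1 : 'Hom(krep1 X, krep1 (ksum (krep_of_sub U) (krep_of_sub V))) :=
  linfun (@split_fun (krep1 X) (ksub1 U) (ksub1 V)).
pose f2 : 'Hom(krep2 X, krep2 (ksum (krep_of_sub U) (krep_of_sub V))) :=
  linfun (@split_fun (krep2 X) (ksub2 U) (ksub2 V)).
have fP i : (f2 \o karr X i = karr (ksum (krep_of_sub U) (krep_of_sub V)) i \o f1)%VF.
  apply/lfunP => w; rewrite !comp_lfunE.
  have [u [v ->]] := split_ex w s1.
  have e : f1 (vsval u + vsval v) = (u, v) by rewrite /f1 split_funE; exact: split_fun_sum.
  rewrite e ksum_arrE linearD.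
  rewrite /f2 split_funE.
  have <- : vsval (karr (krep_of_sub U) i u) + vsval (karr (krep_of_sub V) i v) =
      karr X i (vsval u) + karr X i (vsval v) by rewrite !krep_of_sub_arr.
  exact: split_fun_sum.
exists (KHom fP); have [i1 l1] := split_fun_bij c1 s1.
by have [i2 l2] := split_fun_bij c2 s2.
Qed.

End Transport.

(** * Numerical characterization of regularity *)

Section Regularity.
Variables (k : fieldType) (n : nat) (R : realFieldType) (lam : R).
Hypotheses (lam_gt1 : 1 < lam) (lamE : lam * lam + 1 = n%:R * lam).
Implicit Types X Y : krep k n.

Notation nregular X := (nreg lam (kbot X) (ktop X)).

Lemma tau_nreg X : nregular X -> nregular (tau X).
Proof.
move=> h; apply: (sigma_nreg lam_gt1 lamE (is_sigma_tau X)).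
exact: sigma_nreg (is_sigma_sigma X) h.
Qed.

Lemma tau_neq0 X : nregular X -> (0 < ksize (ktop X))%N ->
  (0 < ksize (ktop (tau X)))%N.
Proof.
move=> h X0; apply: sigma_neq0 (is_sigma_tau X) _ _.
  exact: sigma_nreg (is_sigma_sigma X) h.
exact: sigma_neq0 (is_sigma_sigma X) h X0.
Qed.

Lemma tau_inv_nreg X : nregular X -> nregular (tau_inv X).
Proof. by move=> h; apply/kdual_nreg/tau_nreg/kdual_nreg. Qed.

Lemma tau_inv_neq0 X : nregular X -> (0 < ksize (ktop X))%N ->
  (0 < ksize (ktop (tau_inv X)))%N.
Proof.
move=> h X0; rewrite size_kdual; apply: tau_neq0; first exact: kdual_nreg.
by rewrite size_kdual.
Qed.

Lemma tau_pow_neq0 X t : nregular X -> ~ is_zero X -> ~ is_zero (tau_pow t X).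
Proof.
move=> h; rewrite !is_zeroE => /eqP; rewrite -lt0n => X0; apply/eqP; rewrite -lt0n.
have iterP (f : krep k n -> krep k n) :
    (forall Y, nregular Y -> nregular (f Y)) ->
    (forall Y, nregular Y -> (0 < ksize (ktop Y))%N -> (0 < ksize (ktop (f Y)))%N) ->
    forall s, nregular (iter s f X) /\ (0 < ksize (ktop (iter s f X)))%N.
  move=> f1 f2; elim=> [//|s [IH1 IH2]]; rewrite iterS.
  by split; [apply: f1 | apply: f2].
case: t => s; first by have [] := iterP _ tau_nreg tau_neq0 s.
by have [] := iterP _ tau_inv_nreg tau_inv_neq0 s.+1.
Qed.

Lemma tau_badP X (U : ksub X) : no_split X -> badP lam U ->
  ksize (ktop (tau X)) = 0%N \/ no_split (tau X) /\
  exists2 W : ksub (tau X), badP lam W & (corank1 W < corank1 U)%N.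
Proof.
move=> iX bU.
have [s0|[iS [W bW ltW]]] := sigma_badP lam_gt1 lamE (is_sigma_sigma X) iX bU.
  left; have [y1 y2] := sigma_dim (is_sigma_tau X).
  by move: s0 y1; rewrite /ksize y2; case: (kdim1 (ktop (sigma X))); clear; lia.
have [s0|[iT [Z bZ ltZ]]] := sigma_badP lam_gt1 lamE (is_sigma_tau X) iS bW.
  by left.
by right; split=> //; exists Z => //; apply: ltn_trans ltW.
Qed.

(** [corank1] strictly decreases as long as the orbit is nonzero, so the orbit must reach zero. *)
Lemma tau_iter_zero m X (U : ksub X) : no_split X -> badP lam U ->
  (corank1 U < m)%N -> exists t, is_zero (iter t (@tau k n) X).
Proof.
elim: m => // m IH in X U * => iX bU ltU.
have [s0|[iT [W bW ltW]]] := tau_badP iX bU; first by exists 1%N; apply/is_zeroE.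
have [|t t0] := IH _ W iT bW; first by apply: leq_trans ltW _.
by exists t.+1; rewrite iterSr.
Qed.

Lemma tau_inv_badI X (U : ksub X) : no_split X -> badI lam U ->
  ksize (ktop (tau_inv X)) = 0%N \/ no_split (tau_inv X) /\
  exists2 W : ksub (tau_inv X), badI lam W & (kdim2 W < kdim2 U)%N.
Proof.
move=> iX bU; have [bD cD] := dsub_badP bU.
have [s0|[iT [W bW ltW]]] := tau_badP (kdual_no_split iX) bD.
  by left; rewrite size_kdual.
have [bDW cDW] := dsub_badI bW.
by right; split; [apply: kdual_no_split | exists (dsub W); rewrite // cDW -cD].
Qed.

Lemma tau_inv_iter_zero m X (U : ksub X) : no_split X -> badI lam U ->
  (kdim2 U < m)%N -> exists t, is_zero (iter t (@tau_inv k n) X).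
Proof.
elim: m => // m IH in X U * => iX bU ltU.
have [s0|[iT [W bW ltW]]] := tau_inv_badI iX bU; first by exists 1%N; apply/is_zeroE.
have [|t t0] := IH _ W iT bW; first by apply: leq_trans ltW _.
by exists t.+1; rewrite iterSr.
Qed.

Lemma nreg_no_split X : no_split X -> (forall t, ~ is_zero (tau_pow t X)) ->
  nregular X.
Proof.
move=> iX nz; split=> W _ _ sz; rewrite ltNge; apply/negP => le.
  have [t t0] := tau_iter_zero iX (conj sz le) (ltnSn _).
  exact: (nz (Posz t)).
have [_ z] := deg_bot lam X; rewrite z in le.
have sz' : (0 < ksize W)%N := leq_ltn_trans (leq0n _) sz.
(* Zero steps of [tau_inv] are [tau_pow] at [Posz 0], while t + 1 steps are [tau_pow] at
   [Negz t]. *)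
have [[|t] t0] := tau_inv_iter_zero iX (conj sz' le) (ltnSn _).
  exact: (nz (Posz 0)).
exact: (nz (Negz t)).
Qed.

Lemma nreg_sub X (U : ksub X) :
  nregular (krep_of_sub U) <-> nreg lam (kbot X) U.
Proof.
have [d1 d2] := dim_krep_of_sub U; have inj := sub_incl_inj U.
have [z1 z2] := kdim_bot X; have [z3 z4] := kdim_bot (krep_of_sub U).
have [i1 i2] := sub_incl_img U.
split; apply: nreg_transfer; rewrite ?d1 ?d2 ?z1 ?z2 ?z3 ?z4 // => W _ WU.
  have [e1 e2] := dim_kpreim_inj inj (kle_trans WU i2).
  by exists (kpreim (sub_incl U) W); rewrite kle_bot kle_top e1 e2.
have [e1 e2] := dim_kimg W inj.
exists (kimg (sub_incl U) W); rewrite kle_bot e1 e2; split=> //.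
exact: kle_trans (kle_kimg _ (kle_top W)) i1.
Qed.

Lemma kimg_split X A B (a : khom A X) (b : khom B X) (W : ksub A) (Z : ksub B) :
  kinj a -> kinj b ->
  ksize (kcap (kimg a (ktop A)) (kimg b (ktop B))) = 0%N ->
  kdim1 (kadd (kimg a W) (kimg b Z)) = (kdim1 W + kdim1 Z)%N /\
  kdim2 (kadd (kimg a W) (kimg b Z)) = (kdim2 W + kdim2 Z)%N.
Proof.
move=> ia ib c0; have [c1 c2] := kdim_cap (kimg a W) (kimg b Z).
have /kle_size : kle (kcap (kimg a W) (kimg b Z)) (kcap (kimg a (ktop A)) (kimg b (ktop B))).
  rewrite kle_cap (kle_trans (kle_capl _ _) (kle_kimg _ (kle_top W))).
  exact: kle_trans (kle_capr _ _) (kle_kimg _ (kle_top Z)).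
rewrite c0; have [a1 a2] := dim_kimg W ia; have [b1 b2] := dim_kimg Z ib.
by move: c1 c2; rewrite a1 a2 b1 b2 [ksize _]/ksize; clear; lia.
Qed.

Lemma nreg_summand X N : nregular X -> direct_summand N X -> nregular N.
Proof.
case=> PX IX [N' /ksum_incl[a [b [ia ib c0 [d1 d2]]]]].
have [z1 z2] := kdim_bot X; have [z3 z4] := kdim_bot N.
have [b1 b2] := dim_kimg (ktop N') ib.
(* For [noP] the summand [N] is treated as the quotient of [X] by [N']; for [noI], as a submodule of
   [X]. *)
have PN : noP lam (kimg b (ktop N')) (ktop X).
  by move=> W _ Wt; apply: PX; rewrite ?kle_bot.
split; [apply: noP_transfer PN | apply: noI_transfer IX].
- by rewrite b1 z3 addn0 -d1.
- by rewrite b2 z4 addn0 -d2.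
- move=> W _ _; exists (kadd (kimg a W) (kimg b (ktop N'))).
  have [e1 e2] := kimg_split W (ktop N') ia ib c0.
  by rewrite kle_addr kle_top e1 e2 b1 b2 z3 z4 !addn0.
- move=> W _ _; exists (kimg a W); have [e1 e2] := dim_kimg W ia.
  by rewrite kle_bot kle_top e1 e2 z1 z2 z3 z4 !addn0.
Qed.

Lemma nreg_regular X : nregular X -> regular X.
Proof.
move=> rX N iN sN; split=> // t; apply: tau_pow_neq0; last by case: iN.
exact: nreg_summand sN.
Qed.

Lemma no_split_indecomposable X : no_split X -> ~ is_zero X -> indecomposable X.
Proof.
move=> iX X0; split=> // A B /ksum_incl[a [b [ia ib c0 [d1 d2]]]].
have [a1 a2] := dim_kimg (ktop A) ia; have [b1 b2] := dim_kimg (ktop B) ib.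
have sum : (ksize (kimg a (ktop A)) + ksize (kimg b (ktop B)) = ksize (ktop X))%N.
  by rewrite /ksize a1 a2 b1 b2 -d1 -d2; clear; lia.
case: (iX _ _ c0 sum) => z; [left | right]; apply/is_zeroE.
  by move: z; rewrite /ksize a1 a2.
by move: z; rewrite /ksize b1 b2.
Qed.

Lemma nreg_size0 X (U : ksub X) : ksize U = 0%N -> nreg lam (kbot X) U.
Proof.
move=> U0; split=> W bW WU; first by rewrite U0.
by have := kle_size WU; rewrite U0 leqn0 => /eqP->.
Qed.

Lemma nreg_eq X (U V : ksub X) : kle U V -> (ksize V <= ksize U)%N ->
  nreg lam (kbot X) U -> nreg lam (kbot X) V.
Proof.
move=> leUV sz; have [e1 e2] := kle_eq leUV sz.
have leVU : kle V U by rewrite /kle e1 e2 !subvv.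
apply: nreg_transfer; rewrite /kdim1 /kdim2 ?e1 ?e2 // => W bW WV.
by exists W; split=> //; apply: kle_trans leVU.
Qed.

(** [regular] speaks only of indecomposable summands, so a summand [U] is cut, by induction on its
    size, until [no_split] holds. There [nreg_no_split] applies, and [nreg_sum] reassembles the
    pieces. *)
Lemma regular_split_nreg m X (U V : ksub X) : regular X -> split_sub U V ->
  (ksize U < m)%N -> nreg lam (kbot X) U.
Proof.
move=> rX; elim: m => // m IH in U V * => sUV ltU.
have [U0|Upos] := posnP (ksize U); first exact: nreg_size0.
have [iU|] := classic (no_split (krep_of_sub U)).
  apply/nreg_sub/nreg_no_split => //.
  have nz : ~ is_zero (krep_of_sub U).
    by rewrite is_zeroE size_krep_of_sub; apply/eqP; rewrite -lt0n.
  by have [] := rX _ (no_split_indecomposable iU nz) (summand_split sUV).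
move=> nU; have [P [Q [c0 sum P0 Q0]]] : exists P Q : ksub (krep_of_sub U),
    [/\ ksize (kcap P Q) = 0%N, (ksize P + ksize Q = ksize (ktop (krep_of_sub U)))%N,
        (0 < ksize P)%N & (0 < ksize Q)%N].
  apply: NNPP => no; apply: nU => P Q c0 sum.
  have [?|P0] := posnP (ksize P); first by left.
  have [?|Q0] := posnP (ksize Q); first by right.
  by case: no; exists P, Q.
have inj := sub_incl_inj U; have [i1 _] := sub_incl_img U.
have sizeI W : ksize (kimg (sub_incl U) W) = ksize W.
  by rewrite /ksize; have [-> ->] := dim_kimg W inj.
have leI W : kle (kimg (sub_incl U) W) U := kle_trans (kle_kimg _ (kle_top W)) i1.
have c0' := cap_kimg0 inj c0.
move: (kimg _ P) (kimg _ Q) (sizeI P) (sizeI Q) (leI P) (leI Q) c0' => P' Q'.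
move=> sP sQ PU QU c0' {sizeI leI}.
rewrite size_krep_of_sub -sP -sQ in sum; rewrite -sP in P0; rewrite -sQ in Q0.
have PQU : kle (kadd P' Q') U by rewrite kle_add PU.
have szPQ : (ksize U <= ksize (kadd P' Q'))%N.
  by have := size_cap P' Q'; rewrite c0' sum addn0 => ->.
have [V0 VX] := sUV.
(* A direct summand [A] of [U] is again one of [X], with complement [kadd B V]. *)
have part A B : kle A U -> kle B U -> kle U (kadd A B) ->
    (ksize A + ksize B = ksize U)%N -> split_sub A (kadd B V).
  move=> AU BU UAB s; have h1 := size_cap B V; have h2 := size_cap A (kadd B V).
  have /kle_size h3 : kle (kadd U V) (kadd A (kadd B V)).
    rewrite kle_add (kle_trans UAB) /=; last first.
      by rewrite kle_add kle_addl (kle_trans (kle_addl B V)) ?kle_addr.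
    exact: kle_trans (kle_addr B V) (kle_addr _ _).
  have := size_cap U V; have := kle_size (kle_top (kadd A (kadd B V))).
  by move: h1 h2 h3 V0 VX s; rewrite /split_sub; clear; lia.
have [e1 e2] := kle_eq PQU szPQ.
have UPQ : kle U (kadd P' Q') by rewrite /kle -e1 -e2 !subvv.
have UQP : kle U (kadd Q' P').
  by apply: kle_trans UPQ _; rewrite kle_add kle_addl kle_addr.
apply: nreg_eq PQU szPQ _; apply: nreg_sum => //.
  by apply: (IH _ (kadd Q' V)); [apply: part | move: ltU sum Q0; clear; lia].
by apply: (IH _ (kadd P' V)); [apply: part; rewrite // addnC
                              | move: ltU sum P0; clear; lia].
Qed.

Lemma regular_nreg X : regular X -> nregular X.
Proof.
move=> rX; apply: (regular_split_nreg (V := kbot X) rX _ (ltnSn _)).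
split; last by rewrite [X in (_ + X)%N]/ksize !(kdim_bot X).1 (kdim_bot X).2 !addn0.
by rewrite /ksize /kdim1 /kdim2 /= !capv0 !dimv0.
Qed.

(** * Quotient representations, carried by complements of the subspaces *)

Fact kquo_fun_lin (vT : vectType k) (U : {vspace vT}) :
  linear (fun v : vT => vsproj U^C (v - projv U v)).
Proof.
move=> c a b; rewrite -linearP; congr (vsproj _ _).
by rewrite linearP /= scalerBr opprD addrACA.
Qed.

Definition quo_lfun (vT : vectType k) (U : {vspace vT}) : 'Hom(vT, subvs_of U^C) :=
  linfun (fun v : vT => vsproj U^C (v - projv U v)).

Lemma vsval_quo (vT : vectType k) (U : {vspace vT}) v :
  vsval (quo_lfun U v) = v - projv U v.
Proof. by rewrite (linfunE (@kquo_fun_lin vT U)) vsprojK // memv_projC. Qed.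

Lemma lker_quo (vT : vectType k) (U : {vspace vT}) : lker (quo_lfun U) = U.
Proof.
apply/vspaceP => v; rewrite memv_ker; apply/eqP/idP => [/(congr1 vsval)|vU].
  by rewrite vsval_quo linear0 => /subr0_eq ->; apply: memv_proj.
by apply: subvs_inj; rewrite vsval_quo projv_id // subrr linear0.
Qed.

Lemma quo_lfun0 (vT : vectType k) (U : {vspace vT}) v : v \in U -> quo_lfun U v = 0.
Proof. by move=> vU; apply/eqP; rewrite -memv_ker lker_quo. Qed.

Lemma limg_quo (vT : vectType k) (U : {vspace vT}) : limg (quo_lfun U) = fullv.
Proof.
apply/eqP; rewrite eqEsubv subvf; apply/subvP => w _; apply/memv_imgP.
exists (vsval w); rewrite ?memvf //; apply: subvs_inj; rewrite vsval_quo.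
have : vsval w \in lker (projv U) by rewrite lker_proj subvsP.
by rewrite memv_ker => /eqP ->; rewrite subr0.
Qed.

Definition kquo_arr X (L : ksub X) i (w : subvs_of (ksub1 L)^C) :
    subvs_of (ksub2 L)^C :=
  quo_lfun (ksub2 L) (karr X i (vsval w)).

Definition kquo X (L : ksub X) : krep k n := KRep (fun i => linfun (@kquo_arr X L i)).

Lemma kquo_arrE X (L : ksub X) i w : karr (kquo L) i w = kquo_arr i w.
Proof. by apply: linfunE => c a b; rewrite /kquo_arr !linearP. Qed.

Fact kquo_projP X (L : ksub X) i :
  ((quo_lfun (ksub2 L) : 'Hom(krep2 X, krep2 (kquo L))) \o karr X i =
   karr (kquo L) i \o (quo_lfun (ksub1 L) : 'Hom(krep1 X, krep1 (kquo L))))%VF.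
Proof.
apply/lfunP => v; rewrite !comp_lfunE kquo_arrE /kquo_arr vsval_quo linearB linearB /=.
rewrite [quo_lfun _ (karr X i (projv _ v))]quo_lfun0 ?subr0 //.
by rewrite (subvP (ksubP L i)) // memv_img // memv_proj.
Qed.
Definition kquo_proj X (L : ksub X) : khom X (kquo L) := KHom (kquo_projP L).

Lemma sub_quo_exact X (L : ksub X) : short_exact (sub_incl L) (kquo_proj L).
Proof.
have [i1 i2] := sub_incl_inj L.
split; first by split; apply/lker0P.
  by split; rewrite /= linfun_vsval_img lker_quo.
by split; apply: limg_quo.
Qed.

Lemma dim_kpreim_quo X (L : ksub X) (W : ksub (kquo L)) :
  kdim1 (kpreim (kquo_proj L) W) = (kdim1 W + kdim1 L)%N /\
  kdim2 (kpreim (kquo_proj L) W) = (kdim2 W + kdim2 L)%N.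
Proof.
have dimp (vT : vectType k) (U : {vspace vT}) (Z : {vspace subvs_of U^C}) :
    \dim (quo_lfun U @^-1: Z) = (\dim Z + \dim U)%N.
  rewrite -(limg_ker_dim (quo_lfun U) (quo_lfun U @^-1: Z)) addnC.
  rewrite lpreimK ?limg_quo ?subvf //; congr addn.
  rewrite lker_quo; congr (\dim _); apply/capv_idPr/subvP => v vU.
  by rewrite -memv_preim quo_lfun0 ?mem0v.
by split; apply: dimp.
Qed.

Lemma dim_kquo X (L : ksub X) :
  (kdim1 (ktop (kquo L)) + kdim1 L = kdim1 (ktop X))%N /\
  (kdim2 (ktop (kquo L)) + kdim2 L = kdim2 (ktop X))%N.
Proof.
have [<- <-] := dim_kpreim_quo (ktop (kquo L)).
by split; congr (\dim _); apply/eqP; rewrite eqEsubv subvf; apply/subvP => v _;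
  rewrite -memv_preim memvf.
Qed.

Lemma kquo_nreg X (L : ksub X) : nreg lam L (ktop X) -> nregular (kquo L).
Proof.
have [t1 t2] := dim_kquo L.
have [z1 z2] := kdim_bot (kquo L).
apply: nreg_transfer; rewrite ?z1 ?z2 ?addn0 //.
move=> W _ _; exists (kpreim (kquo_proj L) W); have [e1 e2] := dim_kpreim_quo W.
rewrite kle_top e1 e2 ?addn0; split=> //.
rewrite /kle /=; apply/andP; split; apply/subvP => v vU; rewrite -memv_preim.
  have -> : khom1 (kquo_proj L) v = 0 by apply: quo_lfun0.
  exact: mem0v.
have -> : khom2 (kquo_proj L) v = 0 by apply: quo_lfun0.
exact: mem0v.
Qed.

(** Such a [U] would make [nreg_split] produce a proper nonzero submodule that is regular with
    regular quotient, which elementarity forbids. *)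
Lemma elementary_sub X (U : ksub X) : elementary X ->
  0 < degP lam U -> degI lam U < degI lam (ktop X) -> False.
Proof.
move=> [X0 /regular_nreg rX noext] PU IU; apply: noext.
have [L [L0 LX rL rQ]] := nreg_split lam_gt1 rX PU IU.
exists (krep_of_sub L), (kquo L), (sub_incl L), (kquo_proj L); split.
- exact: sub_quo_exact.
- by rewrite is_zeroE size_krep_of_sub; apply/eqP; rewrite -lt0n.
- rewrite is_zeroE; apply/eqP; rewrite -lt0n.
  by have [t1 t2] := dim_kquo L; move: LX t1 t2; rewrite /ksize; clear; lia.
- exact/nreg_regular/nreg_sub.
- exact/nreg_regular/kquo_nreg.
Qed.

End Regularity.

(** * Ranks of the action map *)

(** The witness is (n + sqrt (n^2 - 4)) / 2. The bound n - 1 < lam amounts to (n - 2)^2 < n^2 - 4,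
    that is n > 2; it makes [degP] positive on dimension vectors (1, r) with r < n. *)
Lemma ex_slope (R : rcfType) (n : nat) : (3 <= n)%N -> exists lam : R,
  [/\ 1 < lam, lam * lam + 1 = n%:R * lam & n%:R - 1 < lam].
Proof.
rewrite -(ler_nat R) => n3; set N : R := n%:R in n3 *.
have sq : Num.sqrt (N * N - 4) * Num.sqrt (N * N - 4) = N * N - 4.
  by rewrite -expr2 sqr_sqrtr //; nra.
have s0 := sqrtr_ge0 (N * N - 4); set s := Num.sqrt _ in sq s0.
have s_gt : N - 2 < s by rewrite ltNge; apply/negP => h; nra.
exists ((N + s) / 2); split; [by lra | | by lra].
have -> : (N + s) / 2 * ((N + s) / 2) = (N * N + 2 * N * s + s * s) / 4 by field.
by rewrite sq; field.
Qed.

Import passmx.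

(** * Eigenvalues over an algebraically closed field *)

Section Endomorphisms.
Variables (k : closedFieldType) (vT : vectType k).

Lemma leigenvalue_root (f : 'End(vT)) a (e := vbasis {:vT}) :
  leigenvalue f a = root (char_poly (mxof e e f)) a.
Proof.
have eb : basis_of {:vT} e := vbasisP _.
by rewrite -eigenvalue_root_char /leigenvalue (leigenspaceE eb) (vsof_eq0 eb).
Qed.

Lemma leigenvalueP (f : 'End(vT)) a :
  reflect (exists2 v, v != 0 & f v = a *: v) (leigenvalue f a).
Proof.
have eigE v : (v \in leigenspace f a) = (f v == a *: v).
  by rewrite memv_ker add_lfunE opp_lfunE scale_lfunE id_lfunE subr_eq0.
apply: (iffP idP) => [ea|[v v0 fv]].
  exists (vpick (leigenspace f a)); first by rewrite vpick0.
  by apply/eqP; rewrite -eigE memv_pick.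
by apply: contraNneq v0 => /vspaceP/(_ v); rewrite memv0 eigE fv eqxx => <-.
Qed.

Lemma ex_eigenvector (f : 'End(vT)) : (0 < \dim {:vT})%N ->
  exists a, exists2 v, v != 0 & f v = a *: v.
Proof.
move=> V0; pose p := char_poly (mxof (vbasis {:vT}) (vbasis {:vT}) f).
have [|a ra] := closed_rootP p _; first by rewrite size_char_poly; case: (\dim _) V0.
by exists a; apply/leigenvalueP; rewrite leigenvalue_root.
Qed.

Lemma ex_non_eigenvalue (f : 'End(vT)) :
  exists2 a, a != 0 & forall v, f v = a *: v -> v = 0.
Proof.
pose p := char_poly (mxof (vbasis {:vT}) (vbasis {:vT}) f).
(* The factor ['X] keeps the chosen nonroot away from zero. *)
have [|a] := closed_nonrootP (p * 'X) _.
  by rewrite mulf_neq0 ?polyX_eq0 ?monic_neq0 ?char_poly_monic.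
rewrite rootM negb_or rootX => /andP[pa a0]; exists a => // v fv.
apply/eqP; apply: contraNT pa => v0; rewrite -leigenvalue_root.
by apply/leigenvalueP; exists v.
Qed.

End Endomorphisms.

Section Action.
Variables (k : fieldType) (n : nat) (M : krep k n).
Notation coefs := {ffun 'I_n -> k^o}.

Definition act_fun (m : krep1 M) (c : coefs) : krep2 M :=
  \sum_i (c i : k) *: karr M i m.
Definition act m : 'Hom(coefs, krep2 M) := linfun (act_fun m).

Lemma actE m c : act m c = \sum_i (c i : k) *: karr M i m.
Proof.
apply: linfunE => a u v; rewrite /act_fun scaler_sumr -big_split.
by apply: eq_bigr => i _; rewrite !ffunE scalerDl scalerA.
Qed.

Lemma actDZ m v t c : act (m + t *: v) c = act m c + t *: act v c.
Proof.
rewrite !actE scaler_sumr -big_split; apply: eq_bigr => i _ /=.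
by rewrite linearD linearZ /= scalerDr !scalerA [_ * t]mulrC.
Qed.

Lemma act_delta m i : act m [ffun j => (j == i)%:R] = karr M i m.
Proof.
rewrite actE (bigD1 i) //= ffunE eqxx scale1r big1 ?addr0 // => j /negPf ji.
by rewrite ffunE ji scale0r.
Qed.

Lemma limg_act m : limg (act m) = ksub2 (gen_ksub m).
Proof.
apply/eqP; rewrite eqEsubv; apply/andP; split.
  apply/subvP => _ /memv_imgP[c _ ->]; rewrite actE memv_suml // => i _.
  rewrite memvZ // memv_span //.
  by apply: (map_f (fun j => karr M j m)); rewrite mem_enum.
apply/span_subvP => _ /mapP[i _ ->]; rewrite -act_delta.
by rewrite memv_img // memvf.
Qed.

Lemma dim_coefs : \dim {: coefs} = n.
Proof. by rewrite dimvf /dim /= card_ord muln1. Qed.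

Lemma act_ker m : (kdim2 (gen_ksub m) < n)%N -> exists2 w, w != 0 & act m w = 0.
Proof.
move=> lt; exists (vpick (lker (act m))); last first.
  by have := memv_pick (lker (act m)); rewrite memv_ker => /eqP.
rewrite vpick0 -dimv_eq0; apply: contraL lt => /eqP z.
have := limg_ker_dim (act m) fullv; rewrite capfv z dim_coefs limg_act.
by rewrite -/(kdim2 _) add0n => e; rewrite -leqNgt e.
Qed.

Lemma act_ker_rank m w : w != 0 -> act m w = 0 -> (kdim2 (gen_ksub m) < n)%N.
Proof.
move=> w0 mw; have := limg_ker_dim (act m) fullv.
rewrite capfv dim_coefs limg_act -/(kdim2 _) => e.
suff : (0 < \dim (lker (act m)))%N by move: e; clear; lia.
rewrite lt0n dimv_eq0.
by apply: contraNneq w0 => k0; rewrite -memv0 -k0 memv_ker mw.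
Qed.

Definition coact_fun (l : 'Hom(krep2 M, k^o)) (v : krep1 M) : coefs :=
  [ffun i => l (karr M i v)].
Definition coact l : 'Hom(krep1 M, coefs) := linfun (coact_fun l).

Lemma coactE l v i : coact l v i = l (karr M i v).
Proof.
have -> : coact l v = coact_fun l v.
  by apply: linfunE => a u w; apply/ffunP => j; rewrite !ffunE !linearP.
by rewrite ffunE.
Qed.

Fact cosubP l i : (karr M i @: lker (coact l) <= lker l)%VS.
Proof.
apply/subvP => _ /memv_imgP[v vK ->]; move: vK; rewrite !memv_ker => /eqP/ffunP/(_ i).
by rewrite coactE ffunE => ->.
Qed.
(** The largest submodule of [M] whose vertex-2 part is killed by [l]. *)
Definition cosub l : ksub M := KSub (cosubP l).

Lemma dim_lker_form (l : 'Hom(krep2 M, k^o)) : l != 0 ->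
  (\dim (lker l) + 1 = \dim {: krep2 M})%N.
Proof.
move=> l0; rewrite -(limg_ker_dim l fullv) capfv; congr addn.
apply/esym/eqP; rewrite eqn_leq; apply/andP; split.
  by rewrite (leq_trans (dimvS (subvf _))) // dimvf.
rewrite lt0n dimv_eq0; apply: contraNneq l0 => lim0; apply/eqP/lfunP => v.
have : l v \in limg l by rewrite memv_img ?memvf.
by rewrite lim0 memv0 zero_lfunE => /eqP.
Qed.

Lemma ex_form : (0 < \dim {: krep2 M})%N -> exists l : 'Hom(krep2 M, k^o), l != 0.
Proof.
move=> y0; exists (vpick fullv); rewrite vpick0 -dimv_eq0 dim_dual.
by rewrite -lt0n.
Qed.

End Action.

(** * Rank bounds for an elementary representation *)

Section ElementaryRanks.
Variables (k : fieldType) (n x y : nat) (M : krep k n).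
Hypotheses (n3 : (3 <= n)%N) (nx : (n < x)%N) (x2n : (x < 2 * n)%N) (yx : (y <= x)%N).
Hypotheses (dimM : dimvec M = (x, y)) (elM : elementary M).
Notation coefs := {ffun 'I_n -> k^o}.

Let dim1 : kdim1 (ktop M) = x. Proof. by case: dimM. Qed.
Let dim2 : kdim2 (ktop M) = y. Proof. by case: dimM. Qed.

Lemma dim_gen1 (m : krep1 M) : m != 0 -> kdim1 (gen_ksub m) = 1%N.
Proof. by rewrite /kdim1 /= dim_vline => ->. Qed.

(** With r the rank, [degP] of the generated submodule is lam - r, positive because r <= n - 1 <
    lam. If r + 2 <= y, then lam (y - r) >= 2 lam > 2 n - 2 >= x - 1, so its [degI] is below that of
    [M], against [elementary_sub]. *)
Lemma gen_rank (m : krep1 M) : m != 0 -> (kdim2 (gen_ksub m) < n)%N ->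
  (y <= (kdim2 (gen_ksub m)).+1)%N.
Proof.
move=> m0; set r := kdim2 _ => rn.
have [lam [lam1 lamE lamn]] := ex_slope (realalg : rcfType) n3.
rewrite leqNgt; apply/negP => ry.
have := elementary_sub lam1 lamE (U := gen_ksub m) elM.
rewrite /degP /degI dim_gen1 // -/r dim1 dim2 => h; apply: h.
  have : r%:R + 1 <= n%:R :> realalg by rewrite -[1]/1%:R -natrD ler_nat addn1.
  by move=> rn'; rewrite mulr1 subr_gt0; apply: le_lt_trans lamn; rewrite lerBrDr.
have ry' : (r + 2)%N%:R <= y%:R :> realalg by rewrite ler_nat addn2.
have xn : x%:R + 1 <= 2 * n%:R :> realalg.
  by rewrite -[1]/1%:R -[2]/2%:R -natrD -natrM ler_nat addn1.
have : 0 <= lam * (y%:R - (r + 2)%N%:R) by rewrite mulr_ge0 ?subr_ge0 // ltW // (lt_trans ltr01).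
by rewrite natrD mulrBr mulrDr; lra.
Qed.

(** A relation [w] among the forms l o gamma_i puts the image of [coact l] in a hyperplane, so
    [cosub l] has dimension vector (u1, y - 1) with u1 >= x - n + 1. Then x - u1 <= n - 1 < lam
    bounds its [degI], and y - 1 <= (n - 1) u1 < lam u1 makes its [degP] positive, against
    [elementary_sub]. *)
Lemma form_independent (l : 'Hom(krep2 M, k^o)) (w : coefs) :
  l != 0 -> w != 0 -> exists v, l (act v w) != 0.
Proof.
move=> l0 w0; apply: NNPP => no.
have lw v : l (act v w) = 0.
  by apply/eqP; apply: contraT => h; case: no; exists v.
have [i wi] : exists i, w i != 0.
  apply: NNPP => wz; case/eqP: w0; apply/ffunP => i; rewrite ffunE.
  by apply/eqP; apply: contraT => h; case: wz; exists i.
(* The nonzero functional with coefficients [w]; its value at [coact l v] is [l (act v w)]. *)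
pose phi_fun (c : coefs) : k^o := \sum_j (w j : k) *: c j.
have phiE c : linfun phi_fun c = phi_fun c.
  apply: linfunE => a u v; rewrite /phi_fun scaler_sumr -big_split.
  by apply: eq_bigr => j _; rewrite !ffunE scalerDr !scalerA [_ * a]mulrC.
have small : (\dim (limg (coact l)) < n)%N.
  have le : (limg (coact l) <= lker (linfun phi_fun))%VS.
    apply/subvP => _ /memv_imgP[v _ ->]; rewrite memv_ker phiE.
    suff -> : phi_fun (coact l v) = l (act v w) by rewrite lw.
    by rewrite actE linear_sum; apply: eq_bigr => j _; rewrite coactE linearZ.
  rewrite (leq_ltn_trans (dimvS le)) // -[X in (_ < X)%N](dim_coefs k n).
  rewrite ltn_neqAle dimvS ?subvf // andbT; apply/eqP => e.
  have /eqP kf : lker (linfun phi_fun) == fullv by rewrite eqEdim subvf e leqnn.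
  have : [ffun j => (j == i)%:R] \in lker (linfun phi_fun) by rewrite kf memvf.
  rewrite memv_ker phiE /phi_fun (bigD1 i) //= ffunE eqxx big1 ?addr0.
    by rewrite -[_ *: _]/(w i * 1) mulr1 (negPf wi).
  by move=> j /negPf ji; rewrite ffunE ji scaler0.
have [lam [lam1 lamE lamn]] := ex_slope (realalg : rcfType) n3.
have d1 : (kdim1 (cosub l) + \dim (limg (coact l)) = x)%N.
  by have := limg_ker_dim (coact l) fullv; rewrite capfv => e; apply: etrans e dim1.
have d2 : (kdim2 (cosub l) + 1 = y)%N by apply: etrans (dim_lker_form l0) dim2.
have := elementary_sub lam1 lamE (U := cosub l) elM.
rewrite /degP /degI dim1 dim2.
move: (kdim1 (cosub l)) (kdim2 (cosub l)) d1 d2 => u1 u2 d1 d2 h; apply: h.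
  have u1n : (x < u1 + n)%N by move: d1 small; clear; lia.
  (* u2 = y - 1 <= x - 1 <= u1 + (n - 2) <= u1 + (n - 2) u1. *)
  have u2le : (u2 + u1 <= n * u1)%N.
    have le : (n - 2 <= (n - 2) * u1)%N by rewrite leq_pmulr //; move: u1n nx; clear; lia.
    by move: le; rewrite mulnBl; move: d2 yx u1n nx n3; clear; nia.
  rewrite -(ler_nat realalg) natrD natrM in u2le.
  have u1pos : 0 < u1%:R :> realalg by rewrite ltr0n; move: u1n nx; clear; lia.
  have : 0 < (lam - (n%:R - 1)) * u1%:R by rewrite mulr_gt0 // subr_gt0.
  by rewrite mulrBl mulrBl mul1r; lra.
have : x%:R + 1 <= u1%:R + n%:R :> realalg.
  by rewrite -[1]/1%:R -!natrD ler_nat; move: d1 small; clear; lia.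
by rewrite -d2 natrD mulrDr; lra.
Qed.

End ElementaryRanks.

Section ClosedField.
Variables (k : closedFieldType) (n : nat) (M : krep k n).
Notation coefs := {ffun 'I_n -> k^o}.

(* An eigenvector of the pencil spanned by two of the arrows. *)
Lemma ex_degenerate : (2 <= n)%N -> (0 < \dim {: krep1 M})%N ->
  (\dim {: krep2 M} <= \dim {: krep1 M})%N ->
  exists (m : krep1 M) (w : coefs), [/\ m != 0, w != 0 & act m w = 0].
Proof.
move=> n2 x0 yx.
pose i0 : 'I_n := Ordinal (ltnW n2); pose i1 : 'I_n := Ordinal n2.
have d_neq0 i : [ffun j => (j == i)%:R] != 0 :> coefs.
  apply/eqP => /ffunP/(_ i); rewrite !ffunE eqxx => /eqP.
  by rewrite oner_eq0.
have [G1|] := eqVneq (lker (karr M i1)) 0%VS; last first.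
  rewrite -vpick0 => m0; exists (vpick (lker (karr M i1))), [ffun j => (j == i1)%:R].
  split=> //; rewrite act_delta.
  by have := memv_pick (lker (karr M i1)); rewrite memv_ker => /eqP.
have G1K : lker (karr M i1) == 0%VS by rewrite G1.
have lim1 : limg (karr M i1) = fullv.
  by apply/eqP; rewrite eqEdim subvf dim_limg_inj.
have [a [m m0 hm]] := ex_eigenvector ((karr M i1)^-1 \o karr M i0)%VF x0.
exists m, ([ffun j => (j == i0)%:R] - a *: [ffun j => (j == i1)%:R]); split=> //.
  apply/eqP => /ffunP/(_ i0); rewrite !ffunE eqxx /=.
  by rewrite [_ *: _]mulr0 subr0 => /eqP; rewrite oner_eq0.
have e : karr M i0 m = a *: karr M i1 m.
  by have := congr1 (karr M i1) hm; rewrite comp_lfunE (bijK lim1) linearZ.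
by rewrite linearB linearZ /= !act_delta e subrr.
Qed.

(* Moving [m] in the direction [v] enlarges the image of [act m] by
   [act v w], because [act (m + t v) w = t (act v w)]. *)
Lemma act_full (l : 'Hom(krep2 M, k^o)) (m v : krep1 M) (w : coefs) :
  limg (act m) = lker l -> act m w = 0 -> l (act v w) != 0 ->
  exists m' : krep1 M, limg (act m') = fullv.
Proof.
move=> im mw lw; set u := act v w in lw.
pose f_fun (p : coefs * k^o) : krep2 M := act m p.1 + (p.2 : k) *: u.
have fE p : linfun f_fun p = f_fun p.
  apply: linfunE => a p1 p2; rewrite /f_fun /= linearP scalerDr scalerDl.
  by rewrite scalerA addrACA.
have limf : limg (linfun f_fun) = fullv.
  apply/eqP; rewrite eqEsubv subvf; apply/subvP => z _; apply/memv_imgP.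
  pose s : k := l z / l u.
  have : z - s *: u \in limg (act m).
    rewrite im memv_ker linearB linearZ /=.
    by rewrite -[s *: _]/(s * l u) /s divfK // subrr.
  case/memv_imgP=> c _ zc; exists (c, s); first exact: memvf.
  by rewrite fE /f_fun /= -zc subrK.
pose g_fun (p : coefs * k^o) : krep2 M := act v p.1.
have gE p : linfun g_fun p = g_fun p.
  by apply: linfunE => a p1 p2; rewrite /g_fun /= linearP.
(* [D] is a section of the surjection given by [f_fun]: it writes z as act m c + d u, and [N] sends
   z to act v c. *)
pose D := (linfun f_fun)^-1%VF; pose N : 'End(krep2 M) := (linfun g_fun \o D)%VF.
(* With t = - 1 / s, a vector z killed by 1 + t N satisfies N z = s z, so choosing s outside the
   spectrum makes 1 + t N bijective. *)
have [s s0 Ns] := ex_non_eigenvalue N.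
pose t := - s^-1; have t0 : t != 0 by rewrite oppr_eq0 invr_eq0.
exists (m + t *: v); apply/eqP; rewrite eqEsubv subvf /=.
have uin : u \in limg (act (m + t *: v)).
  have -> : u = act (m + t *: v) (t^-1 *: w).
    by rewrite linearZ /= actDZ mw add0r scalerA mulVf // scale1r.
  by rewrite memv_img ?memvf.
have inj : lker (\1 + t *: N)%VF == 0%VS.
  rewrite -subv0; apply/subvP => z; rewrite memv_ker memv0 add_lfunE id_lfunE scale_lfunE.
  rewrite addr_eq0 scaleNr opprK => /eqP zN; apply/eqP/Ns.
  by rewrite [in RHS]zN scalerA divff ?scale1r.
have <- : limg (\1 + t *: N)%VF = fullv.
  by apply/eqP; rewrite eqEdim subvf (dim_limg_inj _ inj) leqnn.
(* For z = act m c + d u as above, (1 + t N) z = act (m + t v) c + d u, and both terms lie in the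
   image of act (m + t v). *)
apply/subvP => _ /memv_imgP[z _ ->].
rewrite add_lfunE id_lfunE scale_lfunE comp_lfunE gE /g_fun.
rewrite -{1}[z](bijK limf) fE /f_fun -/D addrAC -actDZ.
by rewrite memvD ?memv_img ?memvf ?memvZ.
Qed.

End ClosedField.

Theorem proposition3p7 (k : closedFieldType) (n x y : nat) (M : krep k n) :
  (3 <= n)%N -> regionF n x y -> (n < x)%N -> (x < 2 * n)%N ->
  dimvec M = (x, y) -> elementary M ->
  exists m' m'' : krep1 M,
    dimvec (krep_of_sub (gen_ksub m')) = (1%N, (y - 1)%N) /\
    dimvec (krep_of_sub (gen_ksub m'')) = (1%N, y).
Proof.
move=> n3 [_ y0 _ yx] nx x2n dimM elM.
have dimx : \dim {: krep1 M} = x by case: dimM.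
have dimy : \dim {: krep2 M} = y by case: dimM.
have rank := gen_rank n3 x2n dimM elM.
have indep := form_independent n3 nx yx dimM elM.
have dimgen (m : krep1 M) : m != 0 ->
    dimvec (krep_of_sub (gen_ksub m)) = (1%N, kdim2 (gen_ksub m)).
  move=> m0; have [d1 d2] := dim_krep_of_sub (gen_ksub m).
  by rewrite -(dim_gen1 m0) -d1 -d2.
(* A degenerate [m] has rank at most n - 1, and [gen_rank] bounds y by that rank plus one. *)
have yn : (y <= n)%N.
  have [||| m [w [m0 w0 mw]]] := @ex_degenerate k n M.
  - exact: ltnW.
  - by rewrite dimx (leq_trans _ nx).
  - by rewrite dimx dimy.
  have rn := act_ker_rank w0 mw.
  exact: leq_trans (rank _ m0 rn) rn.
have [l l0] : exists l : 'Hom(krep2 M, k^o), l != 0 by apply: ex_form; rewrite dimy.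
have dl := dim_lker_form l0; rewrite dimy in dl.
(* [coact l] maps a space of dimension x to one of dimension n < x. *)
have [m [m0 ml]] : exists m, m != 0 /\ m \in lker (coact l).
  exists (vpick (lker (coact l))); split; last exact: memv_pick.
  rewrite vpick0 -dimv_eq0; apply/eqP => K0.
  have := limg_ker_dim (coact l) fullv; rewrite capfv K0 dimx => e.
  have := dimvS (subvf (limg (coact l))); rewrite dim_coefs.
  by rewrite -[\dim (limg _)]add0n e leqNgt nx.
have le_l : (ksub2 (gen_ksub m) <= lker l)%VS.
  by have [_] := gen_ksub_min (U := cosub l) ml.
(* The rank is at most y - 1 by [le_l]; since y - 1 < n, [gen_rank] gives the reverse inequality. *)
have rm : kdim2 (gen_ksub m) = (y - 1)%N.
  have := dimvS le_l; rewrite -/(kdim2 _) => h.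
  have := rank m m0; move: h dl yn y0; clear; lia.
have rn : (kdim2 (gen_ksub m) < n)%N by rewrite rm; move: y0 yn; clear; lia.
have [w w0 mw] := act_ker rn.
have [v lv] := indep l w l0 w0.
have im : limg (act m) = lker l.
  by apply/eqP; rewrite limg_act eqEdim le_l -/(kdim2 _) rm -dl addnK leqnn.
have [m2 full2] := act_full im mw lv.
have r2 : kdim2 (gen_ksub m2) = y by rewrite /kdim2 -limg_act full2.
exists m, m2; rewrite !dimgen ?rm ?r2 //.
apply: contraTneq y0 => m20; rewrite -r2 m20 /kdim2 -limg_act.
have -> : act (0 : krep1 M) = 0.
  apply/lfunP => c; rewrite actE zero_lfunE big1 // => i _.
  by rewrite linear0 scaler0.
by rewrite lim0g dimv0.
Qed.
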